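(* Let $\{Q_i\}_{i\in\bar\Lambda}$ be a complete set of key polynomials for $\nu$. Let $\ell\in\bar\Lambda$ be such that $\ell+\omega\in\bar\Lambda$ and $\alpha_{\ell+t}=1$ for all $t\in\mathbb N$. Put $h=Q_{\ell+\omega}$ (so $\nu(h)>\nu_{\ell+t}(h)$ for all $t\in\mathbb N$) and let $\delta=\delta(h)$ be the stable value of $\delta_{\ell+t}(h)$ for $t$ sufficiently large. Then $\delta=p^e$ for some $e\in\mathbb N_0$, where $p=\operatorname{char}k_\nu$ if $\operatorname{char}k_\nu>0$ and $p=1$ if $\operatorname{char}k_\nu=0$ (in particular, $\delta=1$ whenever $\operatorname{char}k_\nu=0$).
   Context: Setting. $K\subset K(x)$ is a simple transcendental extension, $\nu$ a valuation of $K(x)$ with value group $\Gamma$ and residue field $k_\nu$, $\nu_K=\nu|_K$ with value group $\Gamma_0$; $\operatorname{rank}\nu_K=1$, $\nu(x)>0$. $\tilde\Gamma_0=\Gamma_0\otimes_{\mathbb Z}\mathbb Q$, with a fixed ordered embedding into $\mathbb R$; values are compared in $\Gamma\otimes\mathbb Q$. $\mathbb N$ = positive integers, $\mathbb N_0=\mathbb N\cup\{0\}$. $G_\nu=\bigoplus_{\beta\in\Gamma}\mathbf P_\beta/\mathbf P_{\beta+}$ with $\mathbf P_\beta=\{y\in K(x):\nu(y)\ge\beta\}$, $\mathbf P_{\beta+}=\{y:\nu(y)>\beta\}$; $\mathrm{in}_\nu y$ is the class of $y$ in degree $\nu(y)$; $G_{\nu_K}$ is the analogous algebra for $(K,\nu_K)$.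 For a graded domain $G$, $G^*=\{g/h: g,h\in G,\ h\ne0 \text{ homogeneous}\}$. Index sets. $\Lambda$ is a countable well ordered set with least element $0$; $i+1$ is the successor of $i$, etc. $(\alpha_i)_{i\in\Lambda}$ are positive integers, $\alpha_0=1$. $i$ is inessential if $i+\omega\in\Lambda$ and $\alpha_{i+t}=1$ for all $t\in\mathbb N_0$. For non-maximal $i$, $i+$ denotes $i+\omega$ if $i$ is inessential, and $i+1$ otherwise. Pre-key polynomials: monic $Q_i\in K[x]$ $(i\in\Lambda)$, $Q_0=x$, with $\deg Q_i=\alpha_i\deg Q_{i_0}$ for all non-maximal $i\ge1$ and $i_0<i$ with $i_0+=i$. Put $\beta_i=\nu(Q_i)$, $\bar\alpha_i=\deg_xQ_i$, $\mathbf Q_i=\{Q_q\}_{q<i}$. Standard expansions. An $\ell$-standard monomial is $c\prod_{i\le\ell}Q_i^{\gamma_i}$, $c\in K$, $\gamma_i\in\mathbb N_0$ almost all $0$, with $\gamma_i<\alpha_{i+}$ for $i<\ell$ and, for each inessential $i$, at most one $j$ with $j+=i+$ and $\gamma_j\neq0$ (here $i+$ is computed in $\{q\in\Lambda:q\le\ell\}$). It is $Q_\ell$-free if $\gamma_\ell=0$. A $Q_\ell$-free $\ell$-standard expansion is a finite sum of $Q_\ell$-free $\ell$-standard monomials whose $\nu$-value is the minimum of the values of the monomials. An $\ell$-standard expansion of $g\in K[x]$ is $g=\sum_jc_jQ_\ell^j$ with each $c_j$ a $Q_\ell$-free $\ell$-standard expansion. Set of key polynomials for $\nu$: a set of pre-key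 polynomials such that (a) $\beta_i\in\tilde\Gamma_0$ for $i\ne\max\Lambda$; (b) if $i\ge1$ has an immediate predecessor, $Q_i$ has an $(i-1)$-standard expansion $Q_i=Q_{i-1}^{\alpha_i}+\sum_{j<\alpha_i}\big(\sum_\gamma c_{j,\gamma}M_\gamma\big)Q_{i-1}^j$ where the $c_{j,\gamma}M_\gamma$ are $Q_{i-1}$-free $(i-1)$-standard monomials ($c_{j,\gamma}\in K$, $M_\gamma$ a product of powers of elements of $\mathbf Q_{i-1}$; elements of $K$ if $i=1$), all the monomials appearing have the same $\nu$-value, and $(\mathrm{in}_\nu Q_{i-1})^{\alpha_i}+\sum_{j}\big(\sum_\gamma \mathrm{in}_{\nu_K}c_{j,\gamma}\,\mathrm{in}_\nu M_\gamma\big)(\mathrm{in}_\nu Q_{i-1})^j=0$ is the minimal algebraic relation of $\mathrm{in}_\nu Q_{i-1}$ over $G_{\nu_K}[\mathrm{in}_\nu\mathbf Q_{i-1}]^*$; (c) if $i\geq 1$ has no immediate predecessor, there is $i_0$ with $i_0+=i$, and for every such $i_0$ there is an $i_0$-standard expansion $Q_i=\sum_{j=0}^{\alpha_i}c_{j,i_0}Q_{i_0}^j$; every such expansion satisfies $\nu(Q_i)>\min_j\nu(c_{j,i_0}Q_{i_0}^j)$, and $Q_i$ has the smallest degree among polynomials with this property for all $i_0$ with $i_0+=i$; if $\{\beta_{i'}:i'<i\}$ is bounded in $\tilde\Gamma_0$ (in particular if $i\ne\max\Lambda$) then $c_{\alpha_i,i_0}=1$ and $\min_j\nu(c_{j,i_0}Q_{i_0}^j)=\alpha_i\beta_{i_0}=\nu(c_{0,i_0})$;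 (d) if for some $n$ the set $\{i:\deg Q_i=n\}$ is infinite, then $\{\nu(Q_i):\deg Q_i=n\}$ is cofinal in $\{\nu(f): f\in K[x]\text{ monic},\deg f=n\}$. Truncations. Each $f\in K[x]$ has a unique $Q_i$-expansion $f=\sum_jd_{j,i}Q_i^j$ with $\deg d_{j,i}<\deg Q_i$; put $\nu_i(f)=\min_j\{\nu(d_{j,i})+j\beta_i\}$. For $f\ne0$, $S_i(f)=\{j: d_{j,i}\neq 0,\ \nu(d_{j,i})+j\beta_i=\nu_i(f)\}$ and $\delta_i(f)=\max S_i(f)$; for $i=\ell+t$, $\delta_{\ell+t}(f)$ is eventually constant in $t$. A set of key polynomials is complete if for every nonzero $f\in K[x]$ there is $i\in\Lambda$ with $\nu_i(f)=\nu(f)$. *)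

(* Defs.v *)
From HB Require Import structures.
From mathcomp Require Import all_boot all_order all_algebra.
From mathcomp Require Import finmap.
From mathcomp.multinomials Require Import monalg.
From mathcomp Require Import boolp classical_sets cardinality.

Set Implicit Arguments.
Unset Strict Implicit.
Unset Printing Implicit Defensive.

Import Order.TTheory GRing.Theory Num.Theory Num.Def.
Import Quotient.Exports.

Local Open Scope ring_scope.

(* Totality is an axiom here rather than an [Order.Total] structure, because
   joining the latter with [GRing.Zmodule] outside of rings is incompatible
   with the hierarchy of ssrnum. *)
HB.mixin Record POrderedZmodule_isOrderedAbelian G
    of Num.POrderedZmodule G := {
  oag_leVge : forall x y : G, (x <= y) || (y <= x);
  lerD2r_subproof : forall z x y : G, x <= y -> x + z <= y + z
}.

#[short(type="oagroupType")]
HB.structure Definition OrderedAbelianGroup :=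
  { G of Num.POrderedZmodule G & POrderedZmodule_isOrderedAbelian G }.

Section OAGroupTheory.
Context (G : oagroupType).
Implicit Types x y z t : G.

Lemma oag_leP x y : Order.le_xor_gt x y (minr y x) (minr x y) (maxr y x)
  (maxr x y) (x <= y) (y < x).
Proof. exact/comparable_leP/oag_leVge. Qed.

Lemma oag_leD2r z x y : (x + z <= y + z) = (x <= y).
Proof.
apply/idP/idP; last exact: lerD2r_subproof.
by move=> /(lerD2r_subproof (- z)); rewrite !addrK.
Qed.

Lemma oag_leD x y z t : x <= y -> z <= t -> x + z <= y + t.
Proof.
move=> xy zt; apply: (@le_trans _ _ (y + z)); first by rewrite oag_leD2r.
by rewrite ![y + _]addrC oag_leD2r.
Qed.

Lemma oag_ltleD x y z t : x < y -> z <= t -> x + z < y + t.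
Proof.
move=> xy zt; rewrite lt_neqAle (oag_leD (ltW xy) zt) andbT.
apply: contraTneq xy => e; apply/negP => /lt_geF; rewrite -(oag_leD2r z) e.
by rewrite ![y + _]addrC oag_leD2r zt.
Qed.

End OAGroupTheory.

Definition withtop (T : Type) := option T.
Definition Fin (T : Type) (x : T) : withtop T := Some x.

Section WithTop.
Context (G : oagroupType).

HB.instance Definition _ := Choice.copy (withtop G) (option G).

Definition withtop_le (x y : withtop G) : bool :=
  match x, y with
  | _, None => true
  | None, Some _ => false
  | Some a, Some b => a <= b
  end.

Lemma withtop_le_refl : reflexive withtop_le.
Proof. by case=> //= a; rewrite lexx. Qed.

Lemma withtop_le_anti : antisymmetric withtop_le.
Proof. by move=> [a|] [b|] //= /le_anti ->. Qed.

Lemma withtop_le_trans : transitive withtop_le.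
Proof. by move=> [b|] [a|] [c|] //=; apply: le_trans. Qed.

HB.instance Definition _ := Order.Le_isPOrder.Build ring_display (withtop G)
  withtop_le_refl withtop_le_anti withtop_le_trans.

Lemma withtop_le_total : total (<=%O : rel (withtop G)).
Proof. by move=> [a|] [b|] //; apply: oag_leVge. Qed.

HB.instance Definition _ :=
  Order.POrder_isTotal.Build ring_display (withtop G) withtop_le_total.

Lemma withtop_lex1 (x : withtop G) : (x <= (None : withtop G))%O.
Proof. by case: x. Qed.

HB.instance Definition _ :=
  Order.hasTop.Build ring_display (withtop G) withtop_lex1.

Lemma Fin_le (a b : G) : (Fin a <= Fin b) = (a <= b).
Proof. by []. Qed.

Lemma Fin_lt (a b : G) : (Fin a < Fin b) = (a < b).
Proof. by rewrite !lt_neqAle. Qed.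

End WithTop.

(* The value at 0 is irrelevant: see [vext], which is the valuation with
   values in G and +oo. *)
Record valuation (F : fieldType) (G : oagroupType) := Valuation {
  val_fun :> F -> G;
  valuationM : forall x y, x != 0 -> y != 0 ->
    val_fun (x * y) = val_fun x + val_fun y;
  valuationD : forall x y, x != 0 -> y != 0 -> x + y != 0 ->
    minr (val_fun x) (val_fun y) <= val_fun (x + y)
}.

Definition value_group (F : fieldType) (G : oagroupType)
    (v : valuation F G) : set G :=
  [set g | exists2 y, y != 0 & v y = g]%classic.

Definition vext (F : fieldType) (G : oagroupType) (v : valuation F G)
    (y : F) : withtop G := if y == 0 then \top%O else Fin (v y).

Section ValuationTheory.
Context (F : fieldType) (G : oagroupType) (v : valuation F G).
Implicit Types (x y : F) (a b : G).

Lemma vext0 : vext v 0 = \top%O.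
Proof. by rewrite /vext eqxx. Qed.

Lemma val1 : v 1 = 0.
Proof.
apply: (addrI (v 1)); rewrite addr0.
by rewrite -(valuationM v) ?oner_eq0 // mulr1.
Qed.

Lemma vext1 : vext v 1 = Fin 0.
Proof. by rewrite /vext oner_eq0 val1. Qed.

Lemma valN x : x != 0 -> v (- x) = v x.
Proof.
have v2 y : v y + v y = 0 -> v y = 0.
  move=> e; apply/le_anti.
  case: (oag_leP (v y) 0) => h /=.
    by have := oag_leD h (lexx (v y)); rewrite e add0r.
  by have := oag_ltleD h (lexx (v y)); rewrite e add0r => /(lt_trans h);
     rewrite ltxx.
move=> x0; rewrite -mulN1r (valuationM v) ?oppr_eq0 ?oner_eq0 //.
rewrite (_ : v (-1) = 0) ?add0r // v2 //.
by rewrite -(valuationM v) ?oppr_eq0 ?oner_eq0 // mulrNN mulr1 val1.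
Qed.

Lemma vextN x : vext v (- x) = vext v x.
Proof. by rewrite /vext oppr_eq0; case: eqVneq => // x0; rewrite valN. Qed.

Lemma vextD x y : (minr (vext v x) (vext v y) <= vext v (x + y))%O.
Proof.
have [->|x0] := eqVneq x 0; first by rewrite add0r ge_min lexx orbT.
have [->|y0] := eqVneq y 0; first by rewrite addr0 ge_min lexx.
rewrite /vext (negPf x0) (negPf y0); case: eqVneq => [_|xy0].
  exact: lex1.
have := valuationD v x0 y0 xy0; case: (oag_leP (v x) (v y)) => _ h.
  by rewrite ge_min Fin_le h.
by rewrite ge_min !Fin_le h orbT.
Qed.

Lemma vext_geD a x y :
  Fin a <= vext v x -> Fin a <= vext v y -> Fin a <= vext v (x + y).
Proof. by move=> ax ay; apply: le_trans (vextD x y); rewrite le_min ax. Qed.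

Lemma vext_gtD a x y :
  Fin a < vext v x -> Fin a < vext v y -> Fin a < vext v (x + y).
Proof. by move=> ax ay; apply: lt_le_trans (vextD x y); rewrite lt_min ax. Qed.

Lemma vext_geM a b x y :
  Fin a <= vext v x -> Fin b <= vext v y -> Fin (a + b) <= vext v (x * y).
Proof.
rewrite /vext mulf_eq0.
case: eqVneq => [_|x0]; first by move=> *; apply: lex1.
case: eqVneq => [_|y0]; first by move=> *; apply: lex1.
by rewrite (valuationM v) //; apply: oag_leD.
Qed.

Lemma vext_gtM a b x y :
  Fin a <= vext v x -> Fin b < vext v y -> Fin (a + b) < vext v (x * y).
Proof.
rewrite /vext mulf_eq0.
case: eqVneq => [_|x0]; first by move=> *.
case: eqVneq => [_|y0]; first by move=> *.
rewrite (valuationM v) // !Fin_lt ![_ + b]addrC ![_ + v y]addrC => h1 h2.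
exact: oag_ltleD.
Qed.

End ValuationTheory.

Section ResidueField.
Context (F : fieldType) (G : oagroupType) (v : valuation F G).

Definition valring_pred : {pred F} := [pred y | Fin 0 <= vext v y].

Lemma valring_subring : subring_closed valring_pred.
Proof.
split=> [|x y|x y]; rewrite !inE ?vext1 ?lexx // => x0 y0.
  by apply: vext_geD; rewrite ?vextN.
by rewrite -[0]addr0; apply: vext_geM.
Qed.

HB.instance Definition _ := GRing.isSubringClosed.Build F valring_pred
  valring_subring.

Record valring := Valring { valring_val :> F; _ : valring_val \in valring_pred }.

HB.instance Definition _ := [isSub for valring_val].
HB.instance Definition _ := [Choice of valring by <:].
HB.instance Definition _ := [SubChoice_isSubComNzRing of valring by <:].

Definition valring_max : {pred valring} := [pred y | Fin 0 < vext v (val y)].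

Lemma valring_max_ideal : idealr_closed valring_max.
Proof.
split=> [||a x y]; rewrite !inE ?rmorph0 ?rmorph1 ?vext0 ?vext1 ?ltxx //.
move=> x0 y0; rewrite rmorphD rmorphM; apply: vext_gtD => //.
by rewrite -[0]addr0; apply: vext_gtM => //; apply: (valP a).
Qed.

HB.instance Definition _ := isIdealr.Build valring valring_max valring_max_ideal.

Definition residue_field := {ideal_quot valring_max}.
HB.instance Definition _ := GRing.ComNzRing.on residue_field.

End ResidueField.

Definition char_exponent (R : nzRingType) (p : nat) : Prop :=
  p \in [pchar R] \/ [pchar R] =i pred0 /\ p = 1%N.

(* The group algebra of G over R. The ring structure provided by monalg only
   concerns monoids without non trivial units. *)
Section GroupAlgebra.
Context (G : zmodType) (R : comNzRingType).

Definition group_algebra := {malg R[G]}.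
HB.instance Definition _ := GRing.Zmodule.on group_algebra.
Implicit Types (g : group_algebra) (k : G).

Definition gamul g1 g2 : group_algebra :=
  \sum_(k1 <- msupp g1) \sum_(k2 <- msupp g2)
    << g1@_k1 * g2@_k2 *g k1 + k2 >>.

Definition gaone : group_algebra := << 1 *g 0 >>.

Lemma gamulw (d1 d2 : {fset G}) g1 g2 :
  (msupp g1 `<=` d1)%fset -> (msupp g2 `<=` d2)%fset ->
  gamul g1 g2 = \sum_(k1 <- d1) \sum_(k2 <- d2) << g1@_k1 * g2@_k2 *g k1 + k2 >>.
Proof.
move=> le_d1 le_d2; rewrite /gamul (big_fset_incl _ le_d1) /=.
  apply/eq_bigr=> k1 _; apply/big_fset_incl => // k _ /mcoeff_outdom ->.
  by rewrite mulr0 monalgU0.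
move=> k _ /mcoeff_outdom g1k.
by rewrite big1 => // k' _; rewrite g1k mul0r monalgU0.
Qed.

Lemma gamulC : commutative gamul.
Proof.
move=> g1 g2; rewrite /gamul exchange_big /=.
by apply/eq_bigr=> k1 _; apply/eq_bigr=> k2 _; rewrite mulrC addrC.
Qed.

Lemma gamulUU c1 c2 k1 k2 :
  gamul << c1 *g k1 >> << c2 *g k2 >> = << c1 * c2 *g k1 + k2 >>.
Proof.
by rewrite (gamulw msuppU_le msuppU_le) !big_seq_fset1 !mcoeffUU.
Qed.

Lemma gamulDl : left_distributive gamul +%R.
Proof.
move=> g1 g2 g.
rewrite (gamulw (msuppD_le g1 g2) (fsubset_refl _)).
rewrite (gamulw (fsubsetUl _ (msupp g2)) (fsubset_refl (msupp g))).
rewrite (gamulw (fsubsetUr (msupp g1) _) (fsubset_refl (msupp g))).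
rewrite -big_split /=; apply/eq_bigr=> k1 _.
rewrite -big_split /=; apply/eq_bigr=> k2 _.
by rewrite mcoeffD mulrDl monalgUD.
Qed.

Lemma gamulDr : right_distributive gamul +%R.
Proof. by move=> g g1 g2; rewrite gamulC gamulDl ![gamul _ g]gamulC. Qed.

Lemma gamul0l : left_zero 0 gamul.
Proof. by move=> g; rewrite /gamul msupp0 big_seq_fset0. Qed.

Lemma gamul0r : right_zero 0 gamul.
Proof. by move=> g; rewrite gamulC gamul0l. Qed.

Lemma gamul_suml I (r : seq I) (f : I -> group_algebra) g :
  gamul (\sum_(i <- r) f i) g = \sum_(i <- r) gamul (f i) g.
Proof.
exact: (big_morph (gamul^~ g) (fun _ _ => gamulDl _ _ _) (gamul0l _)).
Qed.

Lemma gamul_sumr I (r : seq I) (f : I -> group_algebra) g :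
  gamul g (\sum_(i <- r) f i) = \sum_(i <- r) gamul g (f i).
Proof.
exact: (big_morph (gamul g) (fun _ _ => gamulDr _ _ _) (gamul0r _)).
Qed.

Lemma gamulA : associative gamul.
Proof.
have [m mE] : {m | m = gamul} by exists gamul.
have ml I (r : seq I) f g : m (\sum_(i <- r) f i) g = \sum_(i <- r) m (f i) g.
  by rewrite mE gamul_suml.
have mr I (r : seq I) f g : m g (\sum_(i <- r) f i) = \sum_(i <- r) m g (f i).
  by rewrite mE gamul_sumr.
rewrite -mE => g1 g2 g3.
rewrite [g1]monalgE !ml; apply/eq_bigr=> k1 _.
rewrite [g2]monalgE ml !mr ml; apply/eq_bigr=> k2 _.
rewrite [g3]monalgE !mr; apply/eq_bigr=> k3 _.
by rewrite mE !gamulUU mulrA addrA.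
Qed.

Lemma gamul1l : left_id gaone gamul.
Proof.
move=> g; rewrite [in LHS](monalgE g) gamul_sumr [RHS]monalgE.
by apply/eq_bigr=> k _; rewrite gamulUU mul1r add0r.
Qed.

Lemma gaone_neq0 : gaone != 0.
Proof. by rewrite monalgU_eq0 oner_eq0. Qed.

HB.instance Definition _ := GRing.Zmodule_isComNzRing.Build group_algebra
  gamulA gamulC gamul1l gamulDl gaone_neq0.

Lemma ga_coeff1 k : (1 : group_algebra)@_k = 1 *+ (0 == k).
Proof. exact: mcoeffU. Qed.

Lemma ga_coeffM g1 g2 k :
  (g1 * g2)@_k = \sum_(k1 <- msupp g1) \sum_(k2 <- msupp g2)
    (g1@_k1 * g2@_k2) *+ (k1 + k2 == k).
Proof.
rewrite [LHS](raddf_sum (mcoeff k)); apply/eq_bigr=> k1 _.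
rewrite [LHS](raddf_sum (mcoeff k)); apply/eq_bigr=> k2 _.
exact: mcoeffU.
Qed.

End GroupAlgebra.

Section GradedAlgebra.
Context (F : fieldType) (G : oagroupType) (v : valuation F G).
Local Notation A := (group_algebra G F).

(* The direct sum of the P_b, b in G *)
Definition rees_pred : {pred A} :=
  fun g => all (fun b => Fin b <= vext v g@_b) (msupp g).

Lemma reesP (g : A) :
  reflect (forall b, Fin b <= vext v g@_b) (g \in rees_pred).
Proof.
apply: (iffP allP) => [h b|h b _]; last exact: h.
by have [/h//|_] := msuppP; rewrite vext0 lex1.
Qed.

Lemma rees_subring : subring_closed rees_pred.
Proof.
split=> [|g1 g2 /reesP h1 /reesP h2|g1 g2 /reesP h1 /reesP h2].
- apply/reesP => b; rewrite ga_coeff1; case: eqVneq => [<-|_].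
    by rewrite vext1.
  by rewrite vext0 lex1.
- by apply/reesP => b; rewrite mcoeffB; apply: vext_geD; rewrite ?vextN.
apply/reesP => b; rewrite ga_coeffM.
elim/big_ind: _ => [|x y|k1 _]; rewrite ?vext0 ?lex1 //; first exact: vext_geD.
elim/big_ind: _ => [|x y|k2 _]; rewrite ?vext0 ?lex1 //; first exact: vext_geD.
case: eqVneq => [<-|_]; last by rewrite vext0 lex1.
exact: vext_geM.
Qed.

HB.instance Definition _ := GRing.isSubringClosed.Build A rees_pred rees_subring.

Record rees := Rees { rees_val :> A; _ : rees_val \in rees_pred }.

HB.instance Definition _ := [isSub for rees_val].
HB.instance Definition _ := [Choice of rees by <:].
HB.instance Definition _ := [SubChoice_isSubComNzRing of rees by <:].

(* The direct sum of the P_{b+}, b in G *)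
Definition rees_plus : {pred rees} :=
  fun g => all (fun b => Fin b < vext v (val g)@_b) (msupp (val g)).

Lemma rees_plusP (g : rees) :
  reflect (forall b, Fin b < vext v (val g)@_b) (g \in rees_plus).
Proof.
apply: (iffP allP) => [h b|h b _]; last exact: h.
by have [/h//|_] := msuppP; rewrite vext0.
Qed.

Lemma rees_plus_ideal : idealr_closed rees_plus.
Proof.
split=> [||a g1 g2 /rees_plusP h1 /rees_plusP h2].
- by apply/rees_plusP => b; rewrite rmorph0 mcoeff0 vext0.
- apply/rees_plusP => /(_ 0); rewrite rmorph1 ga_coeff1 eqxx mulr1n vext1.
  by rewrite ltxx.
apply/rees_plusP => b; rewrite rmorphD mcoeffD; apply: vext_gtD => //.
rewrite rmorphM ga_coeffM.
elim/big_ind: _ => [|x y|k1 _]; rewrite ?vext0 //; first exact: vext_gtD.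
elim/big_ind: _ => [|x y|k2 _]; rewrite ?vext0 //; first exact: vext_gtD.
case: eqVneq => [<-|_]; last by rewrite vext0.
by apply: vext_gtM => //; apply/reesP; apply: (valP a).
Qed.

HB.instance Definition _ := isIdealr.Build rees rees_plus rees_plus_ideal.

(* The direct sum of the P_b / P_{b+} *)
Definition graded_algebra := {ideal_quot rees_plus}.
HB.instance Definition _ := GRing.ComNzRing.on graded_algebra.

(* The class of y in P_b / P_{b+}, for y in P_b (and 0 otherwise) *)
Definition gr_class (b : G) (y : F) : graded_algebra :=
  (\pi_({ideal_quot rees_plus}) (insubd (0 : rees) (<< y *g b >> : A)))%qT.

Definition initial_form (y : F) : graded_algebra := gr_class (v y) y.

Definition homogeneous (z : graded_algebra) : Prop :=
  exists b y, Fin b <= vext v y /\ z = gr_class b y.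

Lemma reesU b y : Fin b <= vext v y -> (<< y *g b >> : A) \in rees_pred.
Proof.
move=> yb; apply/reesP => c; rewrite mcoeffU.
by case: eqVneq => [<-|_]; rewrite ?mulr1n ?mulr0n ?vext0 ?lex1.
Qed.

Lemma gr_class_eq0 b y : Fin b <= vext v y ->
  (gr_class b y == 0) = (Fin b < vext v y).
Proof.
move=> yb; have -> : (0 : graded_algebra) = (\pi_({ideal_quot rees_plus}) 0)%qT.
  exact/esym/pi_zeror.
rewrite /gr_class -Quotient.idealrBE subr0.
have e c : (val (insubd (0 : rees) (<< y *g b >> : A)))@_c = y *+ (b == c).
  by rewrite insubdK ?reesU // mcoeffU.
apply/rees_plusP/idP => [/(_ b)|h c]; rewrite e; first by rewrite eqxx.
by case: eqVneq => [<-|_]; rewrite ?mulr0n ?vext0.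
Qed.

Lemma gr_classD b y z : Fin b <= vext v y -> Fin b <= vext v z ->
  gr_class b (y + z) = gr_class b y + gr_class b z.
Proof.
move=> yb zb; rewrite /gr_class.
rewrite -[RHS](raddfD (\pi_({ideal_quot rees_plus})%qT)); congr (\pi_ _ _)%qT.
apply: val_inj; rewrite rmorphD /= !insubdK ?reesU ?vext_geD //.
exact: monalgUD.
Qed.

Lemma gr_classM b c y z : Fin b <= vext v y -> Fin c <= vext v z ->
  gr_class (b + c) (y * z) = gr_class b y * gr_class c z.
Proof.
move=> yb zc; rewrite /gr_class.
rewrite -[RHS](rmorphM (\pi_({ideal_quot rees_plus})%qT)); congr (\pi_ _ _)%qT.
apply: val_inj; rewrite rmorphM /= !insubdK ?reesU ?vext_geM //.
exact/esym/gamulUU.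
Qed.

End GradedAlgebra.

Inductive generated_subring (R : nzRingType) (S : R -> Prop) : R -> Prop :=
| gen_mem x of S x : generated_subring S x
| gen_one : generated_subring S 1
| gen_sub x y of generated_subring S x & generated_subring S y :
    generated_subring S (x - y)
| gen_mul x y of generated_subring S x & generated_subring S y :
    generated_subring S (x * y).

(* The localisation B^* of a graded subring B of the graded algebra. It is
   computed inside the latter, where all the nonzero homogeneous elements are
   invertible, being initial forms of elements of a field. *)
Definition graded_fractions (F : fieldType) (G : oagroupType)
    (v : valuation F G) (B : graded_algebra v -> Prop) (z : graded_algebra v) :
    Prop :=
  exists g h, [/\ B g, B h, homogeneous h, h != 0 & h * z = g].

(* The relation P(x) = 0, with P monic, has the least degree among the nonzero
   polynomial relations of x over B. *)
Definition minimal_relation (R : comNzRingType) (B : R -> Prop) (x : R)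
    (P : {poly R}) : Prop :=
  [/\ P \is monic, forall j, B P`_j, root P x &
      forall P' : {poly R}, P' != 0 -> (forall j, B P'`_j) -> root P' x ->
        (size P <= size P')%N].

Definition convex_subgroup (G : oagroupType) (H C : set G) : Prop :=
  [/\ (C `<=` H)%classic, C 0, forall x y, C x -> C y -> C (x - y) &
      forall x y, H x -> C y -> 0 <= x -> x <= y -> C x].

(* H has exactly one proper convex subgroup, namely 0 *)
Definition rank_one (G : oagroupType) (H : set G) : Prop :=
  H <> [set 0]%classic /\
  forall C, convex_subgroup H C -> C = [set 0]%classic \/ C = H.

(* i + t and i + omega need not exist in L, hence these relations between i
   and the result j. *)
Section Ordinals.
Context (disp : Order.disp_t) (L : orderType disp).
Implicit Types (i j k : L) (t : nat).

Definition is_maximum i : Prop := forall j, (j <= i)%O.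

Definition is_succ i j : Prop :=
  (i < j)%O /\ forall k, (i < k)%O -> (j <= k)%O.

Fixpoint is_plus i t j : Prop :=
  if t is t'.+1 then exists2 k, is_plus i t' k & is_succ k j else j = i.

Definition is_plus_omega i j : Prop :=
  (forall t, exists2 k, is_plus i t k & (k < j)%O) /\
  forall j', (forall t k, is_plus i t k -> (k < j')%O) -> (j <= j')%O.

End Ordinals.

Section Restriction.
Context (K : fieldType) (G : oagroupType).
Context (nu : valuation {fraction {poly K}} G).

Let cst (c : K) : {fraction {poly K}} := tofrac c%:P.

Lemma restriction_subproofM x y : x != 0 -> y != 0 ->
  nu (cst (x * y)) = nu (cst x) + nu (cst y).
Proof.
move=> x0 y0; rewrite /cst polyCM tofracM (valuationM nu) //;
by rewrite tofrac_eq0 polyC_eq0.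
Qed.

Lemma restriction_subproofD x y : x != 0 -> y != 0 -> x + y != 0 ->
  minr (nu (cst x)) (nu (cst y)) <= nu (cst (x + y)).
Proof.
move=> x0 y0 xy0; rewrite /cst polyCD tofracD (valuationD nu) //;
by rewrite -?tofracD -?polyCD tofrac_eq0 polyC_eq0.
Qed.

(* The restriction of nu to K, still seen as taking values in G *)
Definition restriction : valuation K G :=
  Valuation restriction_subproofM restriction_subproofD.

End Restriction.

(* j-th coefficient of the q-expansion of f: see [digitE] *)
Definition digit (K : fieldType) (q f : {poly K}) (j : nat) : {poly K} :=
  (f %/ q ^+ j) %% q.

Section KeyPolynomials.
Context (K : fieldType) (G : oagroupType).
Context (nu : valuation {fraction {poly K}} G).
Context (disp : Order.disp_t) (L : bOrderType disp).
Context (alpha : L -> nat) (Q : L -> {poly K}).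

Implicit Types (i j k l : L) (f : {poly K}) (n : nat).

Local Notation nuK := (restriction nu).
Local Notation nuv f := (vext nu (tofrac f)).
Local Notation deg f := (size f).-1.
Local Notation beta i := (nu (tofrac (Q i))).
Local Notation init f := (initial_form nu (tofrac f)).

(* The trace on G of the divisible hull of the value group of nuK *)
Definition hull0 : set G :=
  [set b | exists2 n, (0 < n)%N & value_group nuK (b *+ n)]%classic.

(* The element g / n of the divisible hull bounds all the beta_j, j < i *)
Definition betas_bounded i : Prop :=
  exists g n, [/\ value_group nuK g, (0 < n)%N &
                  forall j, (j < i)%O -> beta j *+ n <= g].

(* In the next two definitions, D is an initial segment of L: either L itself,
   or the set of the q <= l. *)
Definition inessential (D : pred L) i : Prop :=
  (exists2 j, is_plus_omega i j & D j) /\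
  forall t k, is_plus i t k -> alpha k = 1%N.

(* j = i+, computed in D *)
Definition is_next (D : pred L) i j : Prop :=
  D j /\ ((inessential D i /\ is_plus_omega i j) \/
          (~ inessential D i /\ is_succ i j)).

Definition prekey_polynomials : Prop :=
  [/\ forall i, (0 < alpha i)%N, alpha \bot%O = 1%N,
      forall i, Q i \is monic, Q \bot%O = 'X &
      forall i i0, ~ is_maximum i -> i != \bot%O -> (i0 < i)%O ->
        is_next predT i0 i -> deg (Q i) = (alpha i * deg (Q i0))%N].

Definition exponent := {fsfun L -> nat with 0%N}.

Definition monomial (e : exponent) : {poly K} :=
  \prod_(i <- finsupp e) Q i ^+ e i.

Definition standard_exponent l (e : exponent) : Prop :=
  let D := [pred q | (q <= l)%O] in
  [/\ forall i, e i != 0%N -> D i,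
      forall i j, (i < l)%O -> is_next D i j -> (e i < alpha j)%N &
      forall i m, inessential D i -> is_next D i m ->
        forall j j', is_next D j m -> is_next D j' m ->
          e j != 0%N -> e j' != 0%N -> j = j'].

(* Finite sums of c_e M_e, the c_e in K *)
Definition expansion := {fsfun exponent -> K with 0}.

Definition expansion_val (c : expansion) : {poly K} :=
  \sum_(e <- finsupp c) (c e) *: monomial e.

(* Q_l-free l-standard expansions. The exponents are pairwise distinct:
   collecting the monomials with the same exponent preserves the condition on
   the value. *)
Definition free_expansion l (c : expansion) : Prop :=
  (forall e, e \in finsupp c -> standard_exponent l e /\ e l = 0%N) /\
  nuv (expansion_val c) =
    \big[Order.min / \top%O]_(e <- finsupp c) nuv (c e *: monomial e).

(* g = \sum_(j <= n) c_j Q_l ^ j is an l-standard expansion of g *)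
Definition standard_expansion l n (c : nat -> {poly K}) (g : {poly K}) : Prop :=
  (forall j : nat, (j <= n)%N -> exists2 a, free_expansion l a & c j = expansion_val a)
  /\ g = \sum_(j < n.+1) c j * Q l ^+ j.

Definition expansion_min l n (c : nat -> {poly K}) : withtop G :=
  \big[Order.min / \top%O]_(j < n.+1) nuv (c j * Q l ^+ j).

(* The graded algebra of nuK is identified with its image by the canonical
   embedding into that of nu, which maps the initial form of c to that of c. *)
Definition initial_subring i : graded_algebra nu -> Prop :=
  generated_subring (fun z => (exists c : K, z = init c%:P) \/
                              (exists2 q, (q < i)%O & z = init (Q q))).

Definition key_successor i' i : Prop :=
  exists c : nat -> expansion,
  [/\ forall j : nat, (j < alpha i)%N -> free_expansion i' (c j),
      Q i = Q i' ^+ alpha i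
            + \sum_(j < alpha i) expansion_val (c j) * Q i' ^+ j,
      forall (j : nat) e, (j < alpha i)%N -> e \in finsupp (c j) ->
        nuv (c j e *: monomial e * Q i' ^+ j) = nuv (Q i' ^+ alpha i) &
      minimal_relation (graded_fractions (initial_subring i')) (init (Q i'))
        ('X^(alpha i) +
         \sum_(j < alpha i)
           (\sum_(e <- finsupp (c j)) init (c j e)%:P * init (monomial e))
             *: 'X^j)].

(* f has standard expansions with respect to all the i0 such that i0+ = i, and
   all of them satisfy the inequality *)
Definition limit_property i f : Prop :=
  forall i0, is_next predT i0 i ->
    (exists n c, standard_expansion i0 n c f) /\
    forall n c, standard_expansion i0 n c f -> expansion_min i0 n c < nuv f.

Definition key_limit i : Prop :=
  [/\ exists i0, is_next predT i0 i,
      forall i0, is_next predT i0 i ->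
        exists c, standard_expansion i0 (alpha i) c (Q i),
      forall i0 c, is_next predT i0 i ->
        standard_expansion i0 (alpha i) c (Q i) ->
        expansion_min i0 (alpha i) c < nuv (Q i),
      forall f, limit_property i f -> (deg (Q i) <= deg f)%N &
      betas_bounded i ->
        forall i0 c, is_next predT i0 i ->
        standard_expansion i0 (alpha i) c (Q i) ->
        [/\ c (alpha i) = 1,
            expansion_min i0 (alpha i) c = Fin (beta i0 *+ alpha i) &
            nuv (c 0%N) = Fin (beta i0 *+ alpha i)]].

Definition key_polynomials : Prop :=
  [/\ prekey_polynomials,
      forall i, ~ is_maximum i -> hull0 (beta i),
      forall i' i, is_succ i' i -> key_successor i' i,
      forall i, i != \bot%O -> (forall i', ~ is_succ i' i) -> key_limit i &
      forall n, infinite_set [set i | deg (Q i) = n]%classic ->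
        forall f, f \is monic -> deg f = n ->
          exists2 i, deg (Q i) = n & nuv f <= nuv (Q i)].

(* The value of the j-th term of the Q_i-expansion of f *)
Definition trunc_term i f (j : nat) : withtop G :=
  if digit (Q i) f j == 0 then \top%O
  else Fin (nu (tofrac (digit (Q i) f j)) + beta i *+ j).

(* As Q_i is monic of positive degree, the j-th coefficient of the
   Q_i-expansion of f vanishes for j >= size f. *)
Definition trunc i f : withtop G :=
  \big[Order.min / \top%O]_(j < size f) trunc_term i f j.

Definition trunc_delta i f : nat :=
  \max_(j < size f | (digit (Q i) f j != 0) && (trunc_term i f j == trunc i f))
    j.

(* d is the stable value of the delta_{l+t}(f) *)
Definition stable_delta l f (d : nat) : Prop :=
  exists N, forall t i, (N <= t)%N -> is_plus l t i -> trunc_delta i f = d.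

Definition complete : Prop :=
  forall f, f != 0 -> exists i, trunc i f = nuv f.

End KeyPolynomials.

Section Digits.
Context (K : fieldType) (q : {poly K}).
Hypotheses (q_monic : q \is monic) (q_gt1 : (1 < size q)%N).

Lemma size_digit (f : {poly K}) j : (size (digit q f j) < size q)%N.
Proof. by rewrite ltn_modp -size_poly_gt0 (ltn_trans _ q_gt1). Qed.

Lemma digitE (f : {poly K}) n : (size f <= n)%N -> f = \sum_(j < n) digit q f j * q ^+ j.
Proof.
have q0 : q != 0 by rewrite -size_poly_gt0 (ltn_trans _ q_gt1).
have H m : f = \sum_(j < m) digit q f j * q ^+ j + f %/ q ^+ m * q ^+ m.
  elim: m => [|m IH]; first by rewrite big_ord0 expr0 divp1 mulr1 add0r.
  rewrite big_ord_recr /= -addrA [LHS]IH; congr (_ + _).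
  rewrite [q ^+ m.+1]exprSr -divp_divl -exprSr exprS mulrA -mulrDl.
  by rewrite addrC -divp_eq.
move=> fn; rewrite {1}(H n) divp_small ?mul0r ?addr0 //.
apply: leq_ltn_trans fn _; rewrite -[size _]prednK ?size_poly_gt0 ?expf_neq0 //.
by rewrite ltnS size_exp leq_pmull // -subn1 subn_gt0.
Qed.

End Digits.

(* Main.v *)
(* For a polynomial f, consider the Newton polygon, with respect to nu, of
   f(x + Y) in K(x)[Y]; its slopes are the nu (x - t), t root of f, so that the
   polygon is additive under products. Let s_i be the largest slope of Q_i.
   The polynomials of degree less than deg Q_i have all their slopes less than
   s_i: this goes by induction on i, as such a polynomial g satisfies
   nu_i'(g) = nu(g) for some i' with i'+ = i, whereas nu_i'(Q_i) < nu(Q_i), and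
   nu_i' is the Gauss valuation min_k (nu(D_k f) + k s_i') for the Hasse
   derivatives D_k. From the Q_i-expansion of f, the last k attaining this
   minimum is delta_i(f) N_i, where N_i is this index for Q_i.

   For f = h = Q_(l+omega) this number decreases with i = l + t, hence has a
   stable value M. If M is not a power of p then some binomial coefficient
   'C(M, c) with 0 < c < M is a unit for nu, and the slopes of D_c h are not
   bounded by any s_(l+t) with t large. On the other hand deg D_c h < deg h, so that
   nu_i(D_c h) = nu(D_c h) for some i with i+ = l+omega, whence all its slopes are
   at most s_i. Thus delta divides the power M of p. *)
Require Import Defs.
From mathcomp Require Import all_boot all_order all_algebra.
From mathcomp Require Import finmap.
From mathcomp Require Import boolp classical_sets cardinality.

Set Implicit Arguments.
Unset Strict Implicit.
Unset Printing Implicit Defensive.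

Import Order.TTheory GRing.Theory.
Local Open Scope ring_scope.

(** * Valuations and Newton polygons *)

Section OAG.
Context (G : oagroupType).
Implicit Types x y z t : G.

Lemma oag_ltNge x y : (x < y) = ~~ (y <= x).
Proof. by case: oag_leP. Qed.

Lemma oag_ltD2r z x y : (x + z < y + z) = (x < y).
Proof. by rewrite !oag_ltNge oag_leD2r. Qed.

Lemma oag_lerBlDr x y z : (x - y <= z) = (x <= z + y).
Proof. by rewrite -[LHS](oag_leD2r y) subrK. Qed.

Lemma oag_ltrBlDr x y z : (x - y < z) = (x < z + y).
Proof. by rewrite -[LHS](oag_ltD2r y) subrK. Qed.

Lemma oag_subr_lt x y z t : x - z <= y - t -> y < x -> t < z.
Proof.
rewrite oag_lerBlDr => h yx; rewrite oag_ltNge; apply/negP => zt.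
have := oag_ltleD yx zt; rewrite oag_ltNge => /negP; apply.
by rewrite -(oag_leD2r (- t)) addrK addrAC.
Qed.

Lemma oag_ltB2 z x y : (z - x < z - y) = (y < x).
Proof.
rewrite oag_ltrBlDr -[X in X < _]add0r addrAC -addrA addrC oag_ltD2r.
by rewrite -[LHS](oag_ltD2r y) add0r subrK.
Qed.

Lemma oag_ltMn n x y : (0 < n)%N -> (x *+ n < y *+ n) = (x < y).
Proof.
have lt m (a b : G) : a < b -> a *+ m.+1 < b *+ m.+1.
  move=> ab; elim: m => [//|m IH].
  by rewrite [a *+ _]mulrS [b *+ _]mulrS (oag_ltleD ab (ltW IH)).
case: n => // n _; apply/idP/idP; last exact: lt.
rewrite !oag_ltNge; apply: contraNN.
by rewrite le_eqVlt => /predU1P[->//|/lt -/(_ n)/ltW].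
Qed.

Lemma oag_leMn n x y : (0 < n)%N -> (x *+ n <= y *+ n) = (x <= y).
Proof.
move=> n0; have := oag_ltMn y x n0; rewrite !oag_ltNge.
by move=> /(congr1 negb); rewrite !negbK.
Qed.

Lemma oag_leMnW n x y : x <= y -> x *+ n <= y *+ n.
Proof. by case: n => [|n] xy; rewrite ?mulr0n // oag_leMn. Qed.

End OAG.

Section ScaledValuation.
Context (F : fieldType) (G : oagroupType) (v : valuation F G) (b : nat).

Lemma scaleval_subproofM x y : x != 0 -> y != 0 ->
  v (x * y) *+ b = v x *+ b + v y *+ b.
Proof. by move=> x0 y0; rewrite valuationM // mulrnDl. Qed.

Lemma scaleval_subproofD x y : x != 0 -> y != 0 -> x + y != 0 ->
  Num.min (v x *+ b) (v y *+ b) <= v (x + y) *+ b.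
Proof.
move=> x0 y0 xy0; have := valuationD v x0 y0 xy0.
case: (oag_leP (v x) (v y)) => h /(oag_leMnW b) h'.
  by apply: le_trans h'; case: oag_leP (oag_leMnW b h).
apply: le_trans h'; have := oag_leMnW b (ltW h).
by case: oag_leP => // /lt_le_trans h1 /h1; rewrite ltxx.
Qed.

Definition scaleval : valuation F G :=
  Valuation scaleval_subproofM scaleval_subproofD.

End ScaledValuation.

Section VextTheory.
Context (F : fieldType) (G : oagroupType) (v : valuation F G).
Implicit Types (x y : F) (a : withtop G).

Lemma vext_neq0 x : x != 0 -> vext v x = Fin (v x).
Proof. by rewrite /vext => /negPf->. Qed.

Lemma vext_geD' a x y : a <= vext v x -> a <= vext v y -> a <= vext v (x + y).
Proof. by move=> ax ay; apply: le_trans (vextD v x y); rewrite le_min ax. Qed.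

Lemma vext_gtD' a x y : a < vext v x -> a < vext v y -> a < vext v (x + y).
Proof. by move=> ax ay; apply: lt_le_trans (vextD v x y); rewrite lt_min ax. Qed.

Lemma vext_ge_sum I (r : seq I) (P : pred I) (f : I -> F) a :
  (forall i, P i -> a <= vext v (f i)) -> a <= vext v (\sum_(i <- r | P i) f i).
Proof.
move=> h; elim/big_ind: _ => // [|x y]; last exact: vext_geD'.
by rewrite vext0 lex1.
Qed.

Lemma vext_gt_sum I (r : seq I) (P : pred I) (f : I -> F) (a : G) :
  (forall i, P i -> Fin a < vext v (f i)) -> Fin a < vext v (\sum_(i <- r | P i) f i).
Proof.
move=> h; elim/big_ind: _ => // [|x y]; last exact: vext_gtD'.
by rewrite vext0.
Qed.

Lemma vextD_lt x y : vext v x < vext v y -> vext v (x + y) = vext v x.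
Proof.
move=> xy; apply/eqP; rewrite eq_le; apply/andP; split; last first.
  by apply: vext_geD' => //; apply: ltW.
rewrite leNgt; apply/negP => h.
have : vext v x < vext v (x + y - y) by apply: vext_gtD'; rewrite ?vextN.
by rewrite addrK ltxx.
Qed.

Lemma vext_eqM x y (a b : G) :
  vext v x = Fin a -> vext v y = Fin b -> vext v (x * y) = Fin (a + b).
Proof.
rewrite /vext mulf_eq0; have [|x0] // := eqVneq x 0; have [|y0] // := eqVneq y 0.
by case=> <- [<-]; rewrite valuationM.
Qed.

Lemma vext_leM2r z x y : vext v x <= vext v y -> vext v (x * z) <= vext v (y * z).
Proof.
have [->|z0] := eqVneq z 0; first by rewrite !mulr0.
have [->|y0] := eqVneq y 0; first by rewrite mul0r vext0 lex1.
have [->|x0] := eqVneq x 0; first by rewrite vext0 (vext_neq0 y0).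
by rewrite !vext_neq0 ?mulf_neq0 // !Fin_le !valuationM // oag_leD2r.
Qed.

Lemma vext_Fin x (a : G) : vext v x = Fin a -> x != 0 /\ v x = a.
Proof. by rewrite /vext; case: eqVneq => // x0 [<-]. Qed.

End VextTheory.

(* Newton polygon of P: the line of slope -a supporting it has height g and
   touches it for the last time at the abscissa N. *)
Definition newton_side (F : fieldType) (G : oagroupType) (v : valuation F G)
    (a : G) (P : {poly F}) (N : nat) (g : G) : Prop :=
  [/\ vext v P`_N = Fin (g - a *+ N),
      forall k, Fin (g - a *+ k) <= vext v P`_k &
      forall k, (N < k)%N -> Fin (g - a *+ k) < vext v P`_k].

Section NewtonSide.
Context (F : fieldType) (G : oagroupType) (v : valuation F G) (a : G).
Implicit Types (P R : {poly F}) (M N : nat) (g h : G).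

Lemma newton_side_neq0 P N g : newton_side v a P N g -> P != 0.
Proof. by case=> e _ _; apply: contraPneq e => ->; rewrite coef0 vext0. Qed.

(** The last points of contact add up, as in Gauss's lemma: among the products contributing to the
    coefficient of index [M + N], all but that of the coefficients [M] and [N] have a factor beyond
    its last contact, hence strictly above its line. *)
Lemma newton_sideM P R M N g h :
  newton_side v a P M g -> newton_side v a R N h ->
  newton_side v a (P * R) (M + N) (g + h).
Proof.
move=> [e1 g1 s1] [e2 g2 s2].
have split i k : (i <= k)%N ->
    g + h - a *+ k = (g - a *+ i) + (h - a *+ (k - i)).
  by move=> ik; rewrite addrACA -opprD -mulrnDr subnKC.
split.
- rewrite coefM (bigD1 (inord M)) //= inordK ?ltnS ?leq_addr //.
  have eMN : vext v (P`_M * R`_(M + N - M)) = Fin (g + h - a *+ (M + N)).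
    by rewrite addKn (vext_eqM e1 e2) (split M) ?leq_addr // addKn.
  rewrite vextD_lt eMN //.
  apply: vext_gt_sum => -[i /= ik] /eqP ne.
  rewrite (split i) //.
  have /orP[lt|lt] : (M < i)%N || (N < M + N - i)%N.
    case: (ltngtP i M) => //=; last first.
      by move=> ei; case: ne; apply: val_inj; rewrite /= inordK ?ltnS ?leq_addr.
    by rewrite ltn_subRL ltn_add2r.
  by rewrite mulrC [_ - _ + _]addrC; apply: vext_gtM; [exact: g2|exact: s1].
  by apply: vext_gtM; [exact: g1|exact: s2].
- move=> k; rewrite coefM; apply: vext_ge_sum => -[i /= ik] _.
  by rewrite (split i) //; apply: vext_geM.
move=> k lt; rewrite coefM; apply: vext_gt_sum => -[i /= ik] _.
rewrite (split i) //.
have /orP[lt'|lt'] : (M < i)%N || (N < k - i)%N.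
  case: (ltnP M i) => //= iM; rewrite ltn_subRL.
  by apply: leq_ltn_trans lt; rewrite leq_add2r.
by rewrite mulrC [_ - _ + _]addrC; apply: vext_gtM; [exact: g2|exact: s1].
by apply: vext_gtM; [exact: g1|exact: s2].
Qed.

Lemma newton_side1 : newton_side v a 1 0 0.
Proof.
split=> [|[|k]|[|k] //]; rewrite coef1 ?vext1 ?mulr0n ?subr0 ?vext0 ?lex1 //.
Qed.

Lemma newton_sideX P N g n :
  newton_side v a P N g -> newton_side v a (P ^+ n) (N * n) (g *+ n).
Proof.
move=> h; elim: n => [|n IH]; first by rewrite muln0; apply: newton_side1.
by rewrite exprS mulnS mulrS; apply: newton_sideM.
Qed.

(* The summand of index d is the last one attaining the least height, hence
   the abscissa of the sum is that of this summand. *)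
Lemma newton_side_sum n (T : nat -> {poly F}) (N : nat -> nat) (h : nat -> G) d :
  (d < n)%N ->
  {homo N : i j / (i < j)%N} ->
  (forall j, (j < n)%N -> T j = 0 \/ newton_side v a (T j) (N j) (h j)) ->
  T d != 0 ->
  (forall j, (j < n)%N -> T j != 0 -> h d <= h j /\ ((d < j)%N -> h d < h j)) ->
  newton_side v a (\sum_(j < n) T j) (N d) (h d).
Proof.
move=> dn Nmono TN Td hmin.
have [|[ed gd sd]] := TN d dn; first by move/eqP: Td.
have ge j k : (j < n)%N -> Fin (h d - a *+ k) <= vext v (T j)`_k.
  move=> jn; case: (TN j jn) => [->|[_ gj _]]; first by rewrite coef0 vext0 lex1.
  have [->|Tj] := eqVneq (T j) 0; first by rewrite coef0 vext0 lex1.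
  by apply: le_trans (gj k); rewrite Fin_le oag_leD2r; case: (hmin j jn Tj).
have gt j k : (j < n)%N -> (j != d) || (N d < k)%N -> (N d <= k)%N ->
    Fin (h d - a *+ k) < vext v (T j)`_k.
  move=> jn jd dk; have [->|Tj] := eqVneq (T j) 0; first by rewrite coef0 vext0.
  case: (TN j jn) => [/eqP|[_ gj sj]]; first by rewrite (negPf Tj).
  have [h1 h2] := hmin j jn Tj.
  (* A summand after [d] has a strictly higher line; one before [d] may have the same line, but its
     last contact comes before the abscissa [N d]. *)
  case: (ltngtP d j) => [dj|jd'|ejd].
  - by apply: lt_le_trans (gj k); rewrite Fin_lt oag_ltD2r h2.
  - apply: (@le_lt_trans _ _ (Fin (h j - a *+ k))); first by rewrite Fin_le oag_leD2r.
    by apply: sj; apply: leq_trans dk; apply: Nmono.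
  - by move: jd; rewrite -ejd eqxx => /= /sd.
split.
- rewrite coef_sum (bigD1 (Ordinal dn)) //= vextD_lt ed //.
  apply: vext_gt_sum => -[j jn] /= ne; apply: gt => //.
  by rewrite -(inj_eq val_inj) /= in ne; rewrite ne.
- by move=> k; rewrite coef_sum; apply: vext_ge_sum => -[j jn] _; apply: ge.
move=> k lt; rewrite coef_sum; apply: vext_gt_sum => -[j jn] _.
by apply: gt => //; rewrite ?lt ?orbT // ltnW.
Qed.

End NewtonSide.

Section Taylor.
Context (K : fieldType) (S : comNzRingType) (iota : {rmorphism {poly K} -> S}).
Implicit Types f g : {poly K}.

(* f(x + Y) as a polynomial in Y, where x = iota 'X *)
Definition taylor f : {poly S} :=
  (map_poly (polyC \o iota \o polyC) f).['X + (iota 'X)%:P].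

Lemma taylorM : {morph taylor : f g / f * g}.
Proof. by move=> f g; rewrite /taylor rmorphM hornerM. Qed.

Lemma taylorX n : {morph taylor : f / f ^+ n}.
Proof. by move=> f; rewrite /taylor rmorphXn horner_exp. Qed.

Lemma taylor_sum n (f : nat -> {poly K}) :
  taylor (\sum_(i < n) f i) = \sum_(i < n) taylor (f i).
Proof. by rewrite /taylor raddf_sum horner_sum. Qed.

Lemma taylor0 : taylor 0 = 0.
Proof. by rewrite /taylor rmorph0 horner0. Qed.

Lemma coef_taylor f k : (taylor f)`_k = iota f^`N(k).
Proof.
have e g : (map_poly (polyC \o iota \o polyC) g).[(iota 'X)%:P] = (iota g)%:P.
  elim/poly_ind: g => [|g c IH]; first by rewrite !rmorph0 horner0.
  rewrite rmorphD rmorphM /= map_polyX map_polyC hornerD hornerM hornerX hornerC IH.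
  by rewrite -polyCM -rmorphM /= -polyCD -rmorphD.
(* The wide form of Taylor's formula keeps the index [k] in range even when [k] is at least the size
   of [f]. *)
rewrite /taylor addrC (nderiv_taylor_wide (n := maxn (size f) k.+1)); first last.
- by rewrite (leq_trans (size_poly _ _)) // leq_maxl.
- exact: mulrC.
have lt : (k < maxn (size f) k.+1)%N by rewrite leq_maxr.
rewrite coef_sum (bigD1 (Ordinal lt)) //= nderivn_map e coefCM coefXn eqxx mulr1.
rewrite big1 ?addr0 // => i ne.
rewrite nderivn_map e coefCM coefXn; case: eqP => ek; rewrite ?mulr0 //.
by case/eqP: ne; apply: val_inj.
Qed.

End Taylor.

(** * Slopes of Taylor expansions *)

Lemma digit_ge_size (K : fieldType) (q f : {poly K}) j :
  (1 < size q)%N -> (size f <= j)%N -> digit q f j = 0.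
Proof.
move=> q1 fj; have q0 : q != 0 by rewrite -size_poly_gt0 ltnW.
rewrite /digit divp_small ?mod0p //; apply: leq_ltn_trans fj _.
rewrite -[size _]prednK ?size_poly_gt0 ?expf_neq0 // ltnS size_exp.
by rewrite leq_pmull // -subn1 subn_gt0.
Qed.

Section Slopes.
Context (K : fieldType) (G : oagroupType).
Context (nu : valuation {fraction {poly K}} G).
Local Notation nuv f := (vext nu (tofrac f)).
Implicit Types (f g q : {poly K}) (a c : G) (b N : nat).

Lemma vext_tofrac f : f != 0 -> nuv f = Fin (nu (tofrac f)).
Proof. by move=> f0; rewrite vext_neq0 // tofrac_eq0. Qed.

(* The slope is the element a / b of the divisible hull of G, whence the
   scaling of nu by b. *)
Definition taylor_side b a f N c : Prop :=
  newton_side (scaleval nu b) a (taylor (@tofrac {poly K}) f) N c.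

Lemma taylor_side_coef b a f N c : taylor_side b a f N c ->
  [/\ vext (scaleval nu b) (tofrac f^`N(N)) = Fin (c - a *+ N),
      forall k, Fin (c - a *+ k) <= vext (scaleval nu b) (tofrac f^`N(k)) &
      forall k, (N < k)%N -> Fin (c - a *+ k) < vext (scaleval nu b) (tofrac f^`N(k))].
Proof. by case=> [e g s]; split=> [|k|k /s]; rewrite -coef_taylor. Qed.

(* The slope a / b is the maximum of (nu f - nu (D_k f)) / k, k > 0. *)
Lemma max_slope f : (1 < size f)%N ->
  exists b a N, [/\ (0 < b)%N, (0 < N)%N & taylor_side b a f N (nu (tofrac f) *+ b)].
Proof.
move=> f1; have f0 : f != 0 by rewrite -size_poly_gt0 ltnW.
set n0 := nu (tofrac f).
pose x k := n0 - nu (tofrac f^`N(k)).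
(* The ratio of [x k] to [k] is the slope between the abscissas 0 and [k]. Here [k] is the last
   index up to [m] at which this ratio is largest, ratios being compared by cross multiplication. *)
pose best m k := [/\ (0 < k <= m)%N, f^`N(k) != 0 &
  forall j, (0 < j <= m)%N -> f^`N(j) != 0 ->
    x j *+ k <= x k *+ j /\ ((k < j)%N -> x j *+ k < x k *+ j)].
have ind m : (forall k, (0 < k <= m)%N -> f^`N(k) = 0) \/ exists k, best m k.
  elim: m => [|m IH]; first by left=> -[|k].
  have [D0|D0] := eqVneq f^`N(m.+1) 0.
    have le_m j : (0 < j <= m.+1)%N -> f^`N(j) != 0 -> (0 < j <= m)%N.
      move=> /andP[-> ]; rewrite leq_eqVlt => /predU1P[-> | ]; first by rewrite D0 eqxx.
      by rewrite ltnS.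
    case: IH => [IH|[k [/andP[k0 km] Dk kP]]]; [left|right].
      move=> k kP; apply/eqP/contraT => Dk.
      by have /eqP := IH k (le_m k kP Dk); rewrite (negPf Dk).
    exists k; split=> //; first by rewrite k0 leqW.
    by move=> j jm Dj; apply: kP => //; apply: le_m.
  right; case: IH => [IH|[k [/andP[k0 km] Dk kP]]].
    exists m.+1; split; rewrite ?leqnn // => j /andP[j0].
    rewrite leq_eqVlt => /predU1P[-> | ]; first by rewrite ltnn.
    by rewrite ltnS => jm; rewrite (IH j) ?j0 ?eqxx.
  (* A tie goes to the larger index, since the last point of contact is wanted. *)
  case: (oag_leP (x k *+ m.+1) (x m.+1 *+ k)) => h.
    exists m.+1; split; rewrite ?leqnn // => j /andP[j0].
    rewrite leq_eqVlt => /predU1P[-> | ]; first by rewrite ltnn.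
    rewrite ltnS => jm Dj; split; last by rewrite ltnNge ltnW.
    have [h1 _] := kP j (introT andP (conj j0 jm)) Dj.
    rewrite -(oag_leMn _ _ k0) -!mulrnA [(m.+1 * k)%N]mulnC [(j * k)%N]mulnC !mulrnA.
    apply: (@le_trans _ _ (x k *+ m.+1 *+ j)); last exact: oag_leMnW.
    by rewrite [X in _ <= X]mulrnAC; apply: oag_leMnW.
  exists k; split=> //; first by rewrite k0 leqW.
  move=> j /andP[j0]; rewrite leq_eqVlt => /predU1P[->|jm] Dj.
    by split=> //; apply: ltW.
  by apply: kP => //; rewrite j0 -ltnS.
case: (ind (size f).-1) => [h|[k [/andP[k0 ks] Dk kP]]].
  (* The derivative of order deg f is the leading coefficient, so the derivatives of positive order
     do not all vanish. *)
  have := h (size f).-1; rewrite leqnn -subn1 subn_gt0 f1 => /(_ isT).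
  move/polyP/(_ 0%N); rewrite coef_nderivn addn0 binn mulr1n coef0 subn1.
  by move/eqP; rewrite -lead_coefE lead_coef_eq0 (negPf f0).
(* The slope is [x k] over [k], so [k] is both the denominator and the last point of contact. *)
exists k, (x k), k; split=> //.
have eq j : (Fin (n0 *+ k - x k *+ j) <= vext (scaleval nu k) (tofrac f^`N(j))) =
    (f^`N(j) == 0) || (x j *+ k <= x k *+ j).
  rewrite {1}/vext tofrac_eq0; case: eqP => [|_]; first by rewrite lex1.
  have -> : x j *+ k = n0 *+ k - nu (tofrac f^`N(j)) *+ k by rewrite mulrnBl.
  by rewrite Fin_le !oag_lerBlDr addrC.
split.
- rewrite coef_taylor vext_neq0 ?tofrac_eq0 //; congr Fin.
  by rewrite /= /x mulrnBl opprB addrC subrK.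
- case=> [|j].
    by rewrite coef_taylor nderivn0 mulr0n subr0 vext_neq0 ?tofrac_eq0 ?lexx.
  rewrite coef_taylor eq; have [//|Dj] := eqVneq f^`N(j.+1) 0.
  apply: (proj1 (kP _ _ Dj)) => /=; rewrite -ltnS prednK ?(ltnW f1) //.
  by rewrite ltnNge; apply: contra Dj => /nderivn_poly0->.
move=> j kj; rewrite coef_taylor.
have [->|Dj] := eqVneq f^`N(j) 0; first by rewrite rmorph0 vext0.
have lt : (0 < j <= (size f).-1)%N.
  rewrite (ltn_trans k0) //= -ltnS prednK ?(ltnW f1) // ltnNge.
  by apply: contra Dj => /nderivn_poly0->.
have /(_ kj) := proj2 (kP _ lt Dj).
have -> : x j *+ k = n0 *+ k - nu (tofrac f^`N(j)) *+ k by rewrite mulrnBl.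
by rewrite vext_neq0 ?tofrac_eq0 // Fin_lt !oag_ltrBlDr addrC.
Qed.

(* In terms of the roots t of q, for an extension of nu to an algebraic closure:
   a / b is the largest of the nu (x - t), N is the number of roots attaining
   it, and all the roots of polynomials of smaller degree are farther from x. *)
Definition key_slope q b a N : Prop :=
  [/\ (0 < b)%N, (0 < N)%N, taylor_side b a q N (nu (tofrac q) *+ b) &
      forall g, g != 0 -> (size g < size q)%N ->
        taylor_side b a g 0 (nu (tofrac g) *+ b)].

Section Truncation.
Context (disp : Order.disp_t) (L : bOrderType disp) (Q : L -> {poly K}).

Section OneIndex.
Context (i : L).

Lemma trunc_termE f j : Q i != 0 ->
  trunc_term nu Q i f j = nuv (digit (Q i) f j * Q i ^+ j).
Proof.
move=> q0; rewrite /trunc_term; case: eqVneq => [->|d0].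
  by rewrite mul0r tofrac0 vext0.
have X n : nu (tofrac (Q i ^+ n)) = nu (tofrac (Q i)) *+ n.
  elim: n => [|n IH]; first by rewrite expr0 tofrac1 Defs.val1.
  by rewrite exprS tofracM valuationM ?tofrac_eq0 ?expf_neq0 // IH mulrS.
rewrite vext_tofrac ?mulf_neq0 ?expf_neq0 // tofracM.
by rewrite valuationM ?tofrac_eq0 ?expf_neq0 // X.
Qed.

Hypotheses (Qmonic : Q i \is monic) (Qsize : (1 < size (Q i))%N).

Lemma truncP f (c : withtop G) :
  reflect (forall j, c <= nuv (digit (Q i) f j * Q i ^+ j)) (c <= trunc nu Q i f).
Proof.
rewrite /trunc; apply: (iffP (bigmin_geP _ _ _ _)) => [[_ h] j|h]; last first.
  by split=> [|j _]; rewrite ?lex1 // trunc_termE ?monic_neq0.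
case: (ltnP j (size f)) => jf.
  by have := h (Ordinal jf) isT; rewrite trunc_termE ?monic_neq0.
by rewrite digit_ge_size // mul0r tofrac0 vext0 lex1.
Qed.

Lemma trunc_le f : trunc nu Q i f <= nuv f.
Proof.
rewrite {2}(digitE Qsize (leqnn (size f))) raddf_sum.
by apply: vext_ge_sum => j _; move: (j : nat); apply/truncP.
Qed.

(** Relative to the largest slope of [Q i], the digits have their last contact at 0 and [Q i] has it
    at [N]. So the term of index [j] has its last contact at [j * N], on a line whose height is the
    value of the term. The least height is the truncation, and the last term attaining it has index
    [trunc_delta]. *)
Lemma taylor_side_trunc f b a N : key_slope (Q i) b a N -> f != 0 ->
  exists2 c, trunc nu Q i f = Fin c &
    taylor_side b a f (trunc_delta nu Q i f * N) (c *+ b).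
Proof.
move=> [b0 N0 sQ sg] f0.
have q0 := monic_neq0 Qmonic.
have fE := digitE Qsize (leqnn (size f)).
pose dg := digit (Q i) f.
have [j0 dj0] : exists j : 'I_(size f), dg j != 0.
  apply/existsP; apply: contraT; rewrite negb_exists => /forallP h.
  move: f0; rewrite fE big1 ?eqxx // => j _.
  by have := h j; rewrite negbK => /eqP; rewrite /dg => ->; rewrite mul0r.
have [j1 _ ej1] := eq_bigmin (x := \top%O) j0 xpredT
  (fun j : 'I_(size f) => trunc_term nu Q i f j) isT (fun j _ => lex1 _).
rewrite -/(trunc nu Q i f) in ej1.
have le_t (j : 'I_(size f)) : trunc nu Q i f <= trunc_term nu Q i f j.
  by apply: bigmin_le_cond.
have dj1 : dg j1 != 0.
  apply/eqP => e; have := le_t j0.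
  by rewrite ej1 /trunc_term -/(dg j1) e eqxx -/(dg j0) (negPf dj0).
pose A : pred 'I_(size f) := fun j => (digit (Q i) f j != 0) &&
  (trunc_term nu Q i f j == trunc nu Q i f).
have Aj1 : A j1 by rewrite /A -/(dg j1) dj1 -ej1 /=.
have [|d Ad ed] := @eq_bigmax_cond _ A (fun j => nat_of_ord j).
  by apply/card_gt0P; exists j1.
have {}ed : trunc_delta nu Q i f = d by rewrite -ed; apply: eq_bigl.
have /andP[dd0 /eqP dt] : A d := Ad.
pose h j := (nu (tofrac (dg j)) + nu (tofrac (Q i)) *+ j).
have tE j : dg j != 0 -> trunc_term nu Q i f j = Fin (h j).
  by rewrite /trunc_term -/(dg j) => /negPf->.
exists (h d); first by rewrite -dt tE.
rewrite /taylor_side {1}fE (taylor_sum _ _ (fun j => dg j * Q i ^+ j)) ed.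
apply: (@newton_side_sum _ _ _ _ (size f) (fun j => taylor _ (dg j * Q i ^+ j))
  (fun j => j * N)%N (fun j => h j *+ b)) => //.
- by move=> x y xy; rewrite ltn_pmul2r.
- move=> j jf; have [e|dj] := eqVneq (dg j) 0; first by left; rewrite e mul0r taylor0.
  right; rewrite taylorM taylorX /h mulrnDl [_ *+ j *+ b]mulrnAC.
  rewrite (_ : j * N = 0 + N * j)%N; last by rewrite add0n mulnC.
  by apply: newton_sideM; [apply: sg; rewrite // size_digit|apply: newton_sideX].
- rewrite taylorM taylorX mulf_neq0 ?expf_neq0 //.
    by apply: (newton_side_neq0 (sg _ dd0 _)); rewrite // size_digit.
  exact: newton_side_neq0 sQ.
move=> j jf Tj; have dj : dg j != 0.
  by apply: contraNneq Tj => ->; rewrite mul0r taylor0.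
have := le_t (Ordinal jf); rewrite -dt !tE // Fin_le => hdj.
split=> [|lt]; first exact: oag_leMnW.
(* In case of equality, [j] would be an index of least value beyond the last one, [d]. *)
rewrite oag_ltMn // lt_neqAle hdj andbT; apply: contraTneq lt => e.
rewrite -leqNgt -ed; apply: (@leq_bigmax_cond _ _ _ (Ordinal jf)).
by rewrite dj /= -dt !tE // e.
Qed.

(** A last contact at 0 would put the point of height nu f on the supporting line, whose height is
    the truncation. *)
Lemma key_slope_trunc_gt0 f b a N : key_slope (Q i) b a N -> f != 0 ->
  trunc nu Q i f < nuv f -> (0 < trunc_delta nu Q i f * N)%N.
Proof.
move=> s f0; have b0 : (0 < b)%N by case: s.
have [c -> /taylor_side_coef[e _ _]] := taylor_side_trunc s f0.
rewrite vext_tofrac // Fin_lt => lt; rewrite lt0n; apply/eqP => M0.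
move: e; rewrite M0 nderivn0 mulr0n subr0 vext_neq0 ?tofrac_eq0 // => -[/= e].
by move: lt; rewrite -(oag_ltMn _ _ b0) e ltxx.
Qed.

(** The line of slope -a' / b' touches the polygon of [q] at some [M > 0] and starts below the
    height nu q, from which the line of slope -a / b starts. As the latter is not above the former
    at [M], it descends more steeply. *)
Lemma key_slope_lt q b a N b' a' N' :
  (0 < b)%N -> q != 0 -> taylor_side b a q N (nu (tofrac q) *+ b) ->
  key_slope (Q i) b' a' N' -> trunc nu Q i q < nuv q ->
  a' *+ b < a *+ b'.
Proof.
move=> b0 q0 /taylor_side_coef[_ s _] s' lt; have b'0 : (0 < b')%N by case: s'.
have M0 := key_slope_trunc_gt0 s' q0 lt.
have [c ec /taylor_side_coef[e _ _]] := taylor_side_trunc s' q0.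
move: lt; rewrite ec vext_tofrac // Fin_lt => lt.
set M := (_ * N')%N in M0 e.
have [x0 ex] := vext_Fin e; set y := nu (tofrac q^`N(M)).
have {}ex : y *+ b' = c *+ b' - a' *+ M := ex.
have := s M; rewrite vext_neq0 // Fin_le => /(oag_leMnW b') h.
have {}h : nu (tofrac q) *+ b *+ b' - a *+ M *+ b' <= c *+ b' *+ b - a' *+ M *+ b.
  by rewrite -!mulrnBl -ex [X in _ <= X]mulrnAC.
rewrite -(oag_ltMn _ _ M0) mulrnAC [X in _ < X]mulrnAC.
by apply: oag_subr_lt h _; rewrite mulrnAC !oag_ltMn.
Qed.

End OneIndex.

(** A steeper line through the same starting point has no other contact, since the polygon stays on
    or above the less steep line. *)
Lemma taylor_side_gt b a b' a' M g :
  (0 < b)%N -> (0 < b')%N -> g != 0 -> a' *+ b < a *+ b' ->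
  taylor_side b' a' g M (nu (tofrac g) *+ b') ->
  taylor_side b a g 0 (nu (tofrac g) *+ b).
Proof.
move=> b0 b'0 g0 lt /taylor_side_coef[_ s _].
have gt k : (0 < k)%N ->
    Fin (nu (tofrac g) *+ b - a *+ k) < vext (scaleval nu b) (tofrac g^`N(k)).
  move=> k0; have := s k; rewrite {1 2}/vext tofrac_eq0; case: eqP => // _.
  rewrite Fin_le Fin_lt => /(oag_leMnW b) h.
  rewrite -(oag_ltMn _ _ b'0).
  have {}h : nu (tofrac g) *+ b *+ b' - a' *+ b *+ k <= nu (tofrac g^`N(k)) *+ b *+ b'.
    by rewrite mulrnAC [a' *+ _ *+ _]mulrnAC -mulrnBl [X in _ <= X]mulrnAC.
  apply: lt_le_trans h; rewrite mulrnBl [a *+ _ *+ _]mulrnAC.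
  by rewrite oag_ltB2 oag_ltMn.
have e0 : vext (scaleval nu b) (tofrac g^`N(0)) = Fin (nu (tofrac g) *+ b - a *+ 0).
  by rewrite nderivn0 mulr0n subr0 vext_neq0 ?tofrac_eq0.
split=> [|[|k]|k k0]; rewrite coef_taylor ?e0 //.
  by apply: ltW; apply: gt.
exact: gt.
Qed.

(** This is the induction step along the key polynomials: some [Q i] bounds the slopes of [g],
    because its truncation computes nu g, whereas [q] has a strictly larger slope, because the
    truncation of [q] is less than nu q. *)
Lemma key_slope_step q : q != 0 -> (1 < size q)%N ->
  (forall g, g != 0 -> (size g < size q)%N -> exists i,
     [/\ Q i \is monic, (1 < size (Q i))%N, exists b a N, key_slope (Q i) b a N,
         trunc nu Q i g = nuv g & trunc nu Q i q < nuv q]) ->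
  exists b a N, key_slope q b a N.
Proof.
move=> q0 q1 h; have [b [a [N [b0 N0 s]]]] := max_slope q1.
exists b, a, N; split=> // g g0 gq.
have [i [mi si [b' [a' [N' s']]] tg tq]] := h g g0 gq.
have lt := key_slope_lt mi si b0 q0 s s' tq.
have [c ec sg] := taylor_side_trunc mi si s' g0.
move: sg; have -> : c = nu (tofrac g) by move: ec; rewrite tg vext_tofrac // => -[].
by apply: taylor_side_gt => //; case: s'.
Qed.

End Truncation.
End Slopes.

(** * Unit binomial coefficients and Hasse derivatives *)

Lemma prime_bin_pfactor p e u : prime p -> ~~ (p %| u)%N ->
  ~~ (p %| 'C(p ^ e * u, p ^ e))%N.
Proof.
move=> p_pr pu; have chF : p \in [pchar {poly 'F_p}] by rewrite pchar_poly pchar_Fp.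
have chFp : p \in [pchar 'F_p] by rewrite pchar_Fp.
rewrite (dvdn_pcharf chFp); move: pu; rewrite (dvdn_pcharf chFp).
(* Modulo [p], the power [(1 + 'X) ^+ (p ^ e * u)] equals [(1 + 'X^(p ^ e)) ^+ u]. Comparing the
   coefficients of degree [p ^ e], the binomial coefficient is congruent to [u]. *)
have coefX n m k : (0 < m)%N -> ((1 + 'X^m) ^+ n : {poly 'F_p})`_(m * k) = 'C(n, k)%:R.
  move=> m0; rewrite exprDn coef_sum.
  rewrite (eq_bigr (fun i : 'I_n.+1 => 'C(n, i)%:R *+ (k == i :> nat))); last first.
    move=> i _; rewrite expr1n mul1r -exprM coefMn coefXn eqn_pmul2l //.
    by case: eqP; rewrite ?mulr1n ?mulr0n ?mul0rn.
  case: (ltnP k n.+1) => kn.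
    rewrite (bigD1 (Ordinal kn)) //= eqxx big1 ?addr0 // => i ne.
    by case: eqP => // ek; case/eqP: ne; apply: val_inj.
  rewrite bin_small // big1 // => i _; case: eqP => // ek.
  by move: kn; rewrite ek leqNgt ltn_ord.
have := coefX (p ^ e * u)%N 1%N (p ^ e)%N isT; rewrite mul1n => <-.
have pe : p.-nat (p ^ e)%N by rewrite pnatX pnat_id.
rewrite expr1 exprM (exprDn_pchar _ _ (_ : [pchar {poly 'F_p}].-nat _)); last first.
  by rewrite (eq_pnat _ (pcharf_eq chF)).
by rewrite expr1n -{2}[(p ^ e)%N]muln1 coefX ?bin1 // expn_gt0 prime_gt0.
Qed.

Section UnitBinomial.
Context (F : fieldType) (G : oagroupType) (v : valuation F G).

Lemma vext_nat_ge0 n : Fin 0 <= vext v n%:R.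
Proof. exact: (rpred_nat (valring_pred v) n). Qed.

Lemma residue_nat_eq0 n : (n%:R == 0 :> residue_field v) = (Fin 0 < vext v n%:R).
Proof.
have -> : (n%:R : residue_field v) =
    (\pi_({ideal_quot (valring_max (v := v))}) (n%:R))%qT.
  by rewrite -(rmorph_nat (\pi_({ideal_quot (valring_max (v := v))})%qT)).
have -> : (0 : residue_field v) = (\pi_({ideal_quot (valring_max (v := v))}) 0)%qT.
  exact/esym/pi_zeror.
by rewrite -Quotient.idealrBE subr0 inE rmorph_nat.
Qed.

Lemma vext_nat_unit n : (0 < n)%N ->
  (forall q, prime q -> (q %| n)%N -> q%:R != 0 :> residue_field v) ->
  vext v n%:R = Fin 0.
Proof.
elim/ltn_ind: n => n IH n0 nP.
have [n1|n1] := leqP n 1.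
  by rewrite (_ : n = 1%N) ?vext1 //; apply/eqP; rewrite eqn_leq n1.
have q_pr := pdiv_prime n1; have qn := pdiv_dvd n; set q := pdiv n in q_pr qn.
have eq : vext v q%:R = Fin 0.
  have := nP q q_pr qn; rewrite residue_nat_eq0 -leNgt => h.
  by apply/eqP; rewrite eq_le h vext_nat_ge0.
rewrite -(divnK qn) natrM (_ : Fin 0 = Fin (0 + 0 : G)); last by rewrite addr0.
apply: vext_eqM => //; apply: IH.
- by rewrite ltn_Pdiv ?prime_gt1.
- by rewrite divn_gt0 ?prime_gt0 // dvdn_leq.
by move=> r r_pr rn; apply: nP => //; apply: dvdn_trans rn (dvdn_div qn).
Qed.

(** In residue characteristic 0 every positive integer is a unit, so [c = 1] works. In residue
    characteristic [p], write [n = p ^ e * u] with [u > 1] prime to [p]: for [c = p ^ e] the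
    binomial coefficient is prime to [p], and the primes other than [p] are units. *)
Lemma unit_binomial p n : char_exponent (residue_field v) p -> (0 < n)%N ->
  (forall e, n <> (p ^ e)%N) ->
  exists2 c, (0 < c < n)%N & vext v 'C(n, c)%:R = Fin 0.
Proof.
case=> [chp|[ch0 ->]] n0 nP; last first.
  have n1 : (1 < n)%N.
    by rewrite ltn_neqAle n0 andbT eq_sym; apply/eqP => n1; case: (nP 0%N); rewrite n1.
  exists 1%N; rewrite // bin1; apply: vext_nat_unit => // q q_pr _.
  by have := ch0 q; rewrite !inE q_pr /= => ->.
have p_pr := pcharf_prime chp.
have [u [e [pu en]]] : exists u e, ~~ (p %| u)%N /\ n = (p ^ e * u)%N.
  have [u pu en] := pfactor_coprime p_pr n0.
  by exists u, (logn p n); rewrite -prime_coprime // mulnC.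
have u1 : (1 < u)%N.
  rewrite ltn_neqAle lt0n; apply/andP; split; apply/eqP => u1.
    by apply: (nP e); rewrite en -u1 muln1.
  by rewrite u1 dvdn0 in pu.
exists (p ^ e)%N.
  by rewrite expn_gt0 prime_gt0 //= en ltn_Pmulr ?expn_gt0 ?prime_gt0.
apply: vext_nat_unit => [|q q_pr qn].
  by rewrite bin_gt0 en leq_pmulr // ltnW.
rewrite -(dvdn_pcharf chp); apply: contraL qn; rewrite dvdn_prime2 // => /eqP <-.
by rewrite en prime_bin_pfactor.
Qed.

End UnitBinomial.

Lemma nderivn_nderivn (R : nzRingType) (f : {poly R}) c d :
  f^`N(c)^`N(d) = f^`N(c + d) *+ 'C(c + d, c).
Proof.
apply/polyP => i; rewrite coefMn !coef_nderivn -!mulrnA addnA; congr (_ *+ _).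
(* After multiplication by c! d! i!, both products of binomial coefficients become (c + d + i)!. *)
apply/eqP; rewrite -(eqn_pmul2r (fact_gt0 c)) -(eqn_pmul2r (fact_gt0 d)).
rewrite -(eqn_pmul2r (fact_gt0 i)).
apply/eqP.
have e1 := @bin_fact (c + d + i) c; have e2 := @bin_fact (d + i) d.
have e3 := @bin_fact (c + d + i) (c + d); have e4 := @bin_fact (c + d) c.
rewrite -addnA addKn in e1; rewrite addKn in e2; rewrite addKn in e3; rewrite addKn in e4.
transitivity (c + d + i)`!.
  rewrite -addnA -e1 ?leq_addr // -e2 ?leq_addr //.
  rewrite -!mulnA; congr (_ * _)%N; rewrite [RHS]mulnC -!mulnA; congr (_ * _)%N.
  by rewrite mulnC -!mulnA; congr (_ * _)%N; rewrite mulnC.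
rewrite -e3 ?leq_addr // -e4 ?leq_addr //.
by rewrite -!mulnA.
Qed.

Lemma size_nderivn_lt (R : nzRingType) (f : {poly R}) c :
  (0 < c)%N -> f != 0 -> (size f^`N(c) < size f)%N.
Proof.
move=> c0 f0; rewrite -(prednK (_ : 0 < size f)%N) ?size_poly_gt0 // ltnS.
apply/leq_sizeP => j fj; rewrite coef_nderivn nth_default ?mul0rn //.
rewrite -(prednK (_ : 0 < size f)%N) ?size_poly_gt0 // -add1n.
exact: leq_add.
Qed.

Section SlopeLemmas.
Context (K : fieldType) (G : oagroupType).
Context (nu : valuation {fraction {poly K}} G).
Local Notation nuv f := (vext nu (tofrac f)).
Implicit Types (f g q : {poly K}) (a v : G) (b c N : nat).

(* The derivative D_c f inherits from f a point of its Newton polygon, which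
   forces it to have a slope at least a / b. *)
Lemma nderivn_slope b a f N v c : (0 < c < N)%N -> vext nu 'C(N, c)%:R = Fin 0 ->
  taylor_side nu b a f N v ->
  f^`N(c) != 0 /\ ~ taylor_side nu b a f^`N(c) 0 (nu (tofrac f^`N(c)) *+ b).
Proof.
move=> /andP[c0 cN] unitC /taylor_side_coef[e s _].
(* Up to the unit binomial coefficient, the derivative of order [N - c] of D_c f is D_N f, whose
   value is that of the last contact. *)
have eD : vext (scaleval nu b) (tofrac f^`N(c)^`N(N - c)) = Fin (v - a *+ N).
  rewrite nderivn_nderivn subnKC ?(ltnW cN) // -mulr_natr tofracM.
  rewrite -[v - _]addr0; apply: vext_eqM => //.
  have [C0 vC] := vext_Fin unitC.
  by rewrite rmorph_nat vext_neq0 //= vC mul0rn.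
have D0 : f^`N(c) != 0.
  apply/eqP => D0; have [+ _] := vext_Fin eD.
  by rewrite D0 raddf0 tofrac0 eqxx.
split=> // /taylor_side_coef[_ _ /(_ (N - c)%N)]; rewrite subn_gt0 => /(_ cN).
(* A last contact at 0 would place D_c f strictly below the line of [f] at the abscissa [c]. *)
have := s c; rewrite eD Fin_lt vext_neq0 ?tofrac_eq0 // Fin_le => h1.
rewrite oag_ltrBlDr -addrA -{1}(subnKC (ltnW cN)) mulrnDr opprD -!addrA addNr addr0.
by move=> /(le_lt_trans h1); rewrite ltxx.
Qed.

(** The last contact cannot move right when the line gets steeper: otherwise the two lines would
    give incompatible bounds on the difference of the heights at [M] and [M']. *)
Lemma taylor_side_index_le b a b' a' f M M' v v' :
  (0 < b)%N -> (0 < b')%N -> a *+ b' < a' *+ b ->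
  taylor_side nu b a f M v -> taylor_side nu b' a' f M' v' -> (M' <= M)%N.
Proof.
move=> b0 b'0 lt /taylor_side_coef[e _ s] /taylor_side_coef[e' s' _].
rewrite leqNgt; apply/negP => MM'; have := s _ MM'; have := s' M.
have [x0 ex] := vext_Fin e; have [x'0 ex'] := vext_Fin e'.
rewrite !vext_neq0 // Fin_lt Fin_le.
set x := nu (tofrac f^`N(M)); set x' := nu (tofrac f^`N(M')).
have {}ex : x *+ b = v - a *+ M := ex.
have {}ex' : x' *+ b' = v' - a' *+ M' := ex'.
have -> : v' = x' *+ b' + a' *+ M' by rewrite ex' subrK.
have -> : v = x *+ b + a *+ M by rewrite ex subrK.
rewrite -!addrA -(subnKC (ltnW MM')) !mulrnDr opprD !addrA addrK.
rewrite addrAC addrK => /(oag_leMnW b); rewrite mulrnDl => h1 h2.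
rewrite subnKC ?(ltnW MM') // in h2.
have {}h2 : (x *+ b - a *+ (M' - M)) *+ b' < x' *+ b *+ b' by rewrite oag_ltMn.
have D0 : (0 < M' - M)%N by rewrite subn_gt0.
have : a' *+ b *+ (M' - M) < a *+ b' *+ (M' - M).
  rewrite -(oag_ltB2 (x *+ b *+ b')) ![_ *+ _ *+ (M' - M)]mulrnAC.
  rewrite mulrnBl in h2; apply: lt_le_trans h2 _.
  by rewrite -(oag_leD2r (a' *+ (M' - M) *+ b)) subrK mulrnAC [X in _ <= X]mulrnAC.
by rewrite oag_ltMn // => /(lt_trans lt); rewrite ltxx.
Qed.

End SlopeLemmas.

(** * Ordinals and standard exponents *)

Section OrdinalTheory.
Context (disp : Order.disp_t) (L : orderType disp).
Implicit Types (i j k m : L) (s t : nat).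
Local Open Scope order_scope.

Lemma is_succ_inj i j j' : is_succ i j -> is_succ i j' -> j = j'.
Proof.
by move=> [ij h] [ij' h']; apply/le_anti; rewrite (h _ ij') (h' _ ij).
Qed.

Lemma is_succ_le i j k : is_succ i j -> k < j -> k <= i.
Proof. by move=> [_ h]; rewrite leNgt; apply: contraTN => /h; rewrite leNgt. Qed.

Lemma is_plus_inj i t j j' : is_plus i t j -> is_plus i t j' -> j = j'.
Proof.
elim: t j j' => [|t IH] j j' /=; first by move=> -> ->.
move=> [k ik kj] [k' ik' kj']; rewrite (IH _ _ ik ik') in kj.
exact: is_succ_inj kj kj'.
Qed.

Lemma is_plusD i s m t k : is_plus i s m -> is_plus m t k -> is_plus i (s + t) k.
Proof.
move=> im; elim: t k => [|t IH] k /=; first by rewrite addn0 => ->.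
by move=> [k' mk' kk']; rewrite addnS; exists k' => //; apply: IH.
Qed.

Lemma is_plus_le i t j : is_plus i t j -> i <= j.
Proof.
elim: t j => [|t IH] j /=; first by move=> ->.
by move=> [k /IH ik [kj _]]; apply: le_trans ik (ltW kj).
Qed.

Lemma is_plus_mono i s t j k : (s <= t)%N -> is_plus i s j -> is_plus i t k -> j <= k.
Proof.
elim: t k => [|t IH] k; first by rewrite leqn0 => /eqP-> ij /(is_plus_inj ij)->.
rewrite leq_eqVlt => /predU1P[-> ij /(is_plus_inj ij)->//|st ij [k' ik' [k'k _]]].
exact: le_trans (IH _ st ij ik') (ltW k'k).
Qed.

Lemma is_plus_upto i t k m : is_plus i t k -> i <= m -> m <= k ->
  exists s, is_plus i s m.
Proof.
move=> + im; elim: t k => [|t IH] k /= => [-> mi|[k' ik' [kk' h]] mk].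
  by exists 0%N; apply/le_anti; rewrite im mi.
case: (leP m k') => [|k'm]; first exact: IH.
exists t.+1; rewrite (_ : m = k); last by apply/le_anti; rewrite mk h.
by exists k'.
Qed.

Lemma is_plus_from i t k m : is_plus i t k -> i <= m -> m <= k ->
  exists s, is_plus m s k.
Proof.
move=> + im; elim: t k => [|t IH] k /= => [-> mi|[k' ik' [kk' h]] mk].
  by exists 0%N; apply/le_anti; rewrite im mi.
case: (leP m k') => [mk'|k'm].
  by have [s ms] := IH _ ik' mk'; exists s.+1; exists k'.
by exists 0%N; apply/le_anti; rewrite mk h.
Qed.

Lemma is_plus_omega_inj i j j' : is_plus_omega i j -> is_plus_omega i j' -> j = j'.
Proof.
move=> [h1 h2] [h1' h2']; apply/le_anti/andP; split; [apply: h2|apply: h2'] => t k ik.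
  by have [k' ik' lt] := h1' t; rewrite (is_plus_inj ik ik').
by have [k' ik' lt] := h1 t; rewrite (is_plus_inj ik ik').
Qed.

Lemma is_plus_omega_lt i j : is_plus_omega i j -> i < j.
Proof. by move=> [h _]; have [k ->] := h 0%N. Qed.

Lemma is_plus_omega_cofinal i j m : is_plus_omega i j -> m < j ->
  exists t k, is_plus i t k /\ m <= k.
Proof.
move=> [_ h] mj; apply: contrapT => nh.
have : j <= m.
  apply: h => t k ik; rewrite ltNge; apply/negP => mk; apply: nh.
  by exists t, k.
by rewrite leNgt mj.
Qed.

Lemma is_plus_omega_between i j m : is_plus_omega i j -> i <= m -> m < j ->
  exists t, is_plus i t m.
Proof.
move=> ij im /(is_plus_omega_cofinal ij)[t [k [ik mk]]].
exact: is_plus_upto ik im mk.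
Qed.

Lemma is_plus_omega_nosucc i j k : is_plus_omega i j -> ~ is_succ k j.
Proof.
move=> ij kj; have [t [m [im km]]] := is_plus_omega_cofinal ij (proj1 kj).
have [m' /= [k' ik' k'm'] m'j] := proj1 ij t.+1.
rewrite -(is_plus_inj im ik') in k'm'.
have := proj2 kj m' (le_lt_trans km (proj1 k'm')).
by rewrite leNgt m'j.
Qed.

Lemma is_plus_omega_shift i j t m : is_plus_omega i j -> is_plus i t m ->
  is_plus_omega m j.
Proof.
move=> ij im; split=> [s|j' h].
  have [k ik kj] := proj1 ij (t + s)%N; exists k => //.
  elim: s k ik {kj} => [|s IH] k /=; first by rewrite addn0 => /is_plus_inj; apply.
  by rewrite addnS => -[k' ik' k'k]; exists k' => //; apply: IH.
apply: (proj2 ij) => t' k ik; case: (leP k m) => [km|/ltW mk].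
  by apply: le_lt_trans km (h 0%N m _).
have [s ms] := is_plus_from ik (is_plus_le im) mk.
exact: h ms.
Qed.

End OrdinalTheory.

Section Next.
Context (disp : Order.disp_t) (L : bOrderType disp) (alpha : L -> nat).
Hypothesis alpha_gt0 : forall i, (0 < alpha i)%N.
Implicit Types (i j k m : L) (e : exponent L).
Local Open Scope order_scope.
Local Notation upto l := [pred q : L | (q <= l)%O].

Lemma inessential_sub (D D' : pred L) i : (forall j, D j -> D' j) ->
  inessential alpha D i -> inessential alpha D' i.
Proof. by move=> DD' [[j ij Dj] h]; split=> //; exists j => //; apply: DD'. Qed.

Lemma inessential_upto i i' k : i' <= i ->
  inessential alpha (upto i') k -> inessential alpha (upto i) k.
Proof. by move=> le; apply: inessential_sub => j /= /le_trans; apply. Qed.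

Lemma inessential_plus D i t k : is_plus i t k ->
  inessential alpha D i -> inessential alpha D k.
Proof.
move=> ik [[j ij Dj] h]; split; first by exists j => //; apply: is_plus_omega_shift ij ik.
by move=> s k' /(is_plusD ik); apply: h.
Qed.

Lemma is_next_inj D i j j' : is_next alpha D i j -> is_next alpha D i j' -> j = j'.
Proof.
move=> [_ [[h1 h2]|[h1 h2]]] [_ [[h1' h2']|[h1' h2']]] //.
  exact: is_plus_omega_inj h2 h2'.
exact: is_succ_inj h2 h2'.
Qed.

Lemma is_next_lt D i j : is_next alpha D i j -> i < j.
Proof. by move=> [_ [[_ /is_plus_omega_lt]|[_ []]]]. Qed.

(** Nothing lies between [i'] and its successor, so [i'] is inessential here, and m = i' + t with t
    > 0 is then inessential with the same limit. *)
Lemma is_next_between i i' m : is_next alpha (upto i) i' i -> i' < m -> m < i ->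
  is_next alpha (upto i) m i /\ exists k, is_succ k m.
Proof.
move=> [Di [[ei oi]|[_ [_ h]]]] i'm mi; last by have := h _ i'm; rewrite leNgt mi.
have [[|t] it] := is_plus_omega_between oi (ltW i'm) mi.
  by move: i'm; rewrite it ltxx.
split; last by have [k _ km] := it; exists k.
split=> //; left; split; first exact: inessential_plus it ei.
exact: is_plus_omega_shift oi it.
Qed.

Lemma is_next_limit i i' : (forall k, ~ is_succ k i) ->
  is_next alpha predT i' i -> is_next alpha (upto i) i' i.
Proof.
move=> nsucc [_ [[[_ h] oi]|[_ /nsucc//]]]; split=> /=; first exact: lexx.
by left; split=> //; split=> //; exists i; rewrite //= lexx.
Qed.

Section Step.
Context (i i' : L) (i'i : is_next alpha (upto i) i' i).

Lemma is_next_restrict k m : is_next alpha (upto i) k m -> m <= i' ->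
  is_next alpha (upto i') k m.
Proof.
have lt := is_next_lt i'i.
move=> [_ [[[_ h] om]|[ne sm]]] mi'; split=> //; [left|right]; split=> //.
  by split=> //; exists m.
by move/(inessential_upto (ltW lt)).
Qed.

(** Cutting at [i'] removes the limit [m], so that [k] is no longer inessential and k+ drops to k +
    1, where [alpha] is 1. This forces the exponent of [k] to vanish in an i'-standard monomial. *)
Lemma is_next_across k m : is_next alpha (upto i) k m -> k < i' -> i' < m ->
  exists2 k1, is_next alpha (upto i') k k1 & alpha k1 = 1%N.
Proof.
move=> [_ [[[_ h] om]|[ne [_ sm]]]] ki' i'm; last first.
  by have := sm _ ki'; rewrite leNgt i'm.
have [k1 kk1 _] := proj1 om 1%N; exists k1; last exact: h kk1.
have {}kk1 : is_succ k k1 by case: kk1 => k2 /= ->.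
split; first exact: (proj2 kk1).
right; split=> // -[[m' om' /= m'i'] _].
by move: i'm; rewrite (is_plus_omega_inj om om') ltNge m'i'.
Qed.

(** Only an index that becomes inessential in passing from [i'] to [i] changes its next index. Its
    limit is then beyond [i'], hence is [i], all the indices strictly between being successors. *)
Lemma is_next_extend k m : is_next alpha (upto i') k m ->
  is_next alpha (upto i) k m \/ is_next alpha (upto i) k i.
Proof.
have lt := is_next_lt i'i.
move=> [/= mi' [[ik om]|[nik sm]]].
  left; split; first exact: le_trans mi' (ltW lt).
  by left; split=> //; apply: inessential_upto ik; apply: ltW.
have [ik|nik'] := pselect (inessential alpha (upto i) k); last first.
  left; split; first exact: le_trans mi' (ltW lt).
  by right.
right; have [[j oj /= ji] h] := ik.
split; rewrite /= ?lexx //; left; split=> //.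
move: ji; rewrite le_eqVlt => /predU1P[<-//|ji].
have i'j : i' < j.
  by rewrite ltNge; apply/negP => ji'; apply: nik; split=> //; exists j.
have [_ [k' /(is_plus_omega_nosucc oj)//]] := is_next_between i'i i'j ji.
Qed.

(** Among the indices whose next index is [i], those before [i'] have exponent 0 by
    [is_next_across], and those after [i'] by the support of [e]. So putting [j] at [i'] respects
    the condition on inessential indices. *)
Lemma standard_exponent_extend e (j : nat) :
  standard_exponent alpha i' e -> e i' = 0%N -> (j < alpha i)%N ->
  standard_exponent alpha i [fsfun e with i' |-> j] /\ [fsfun e with i' |-> j] i = 0%N.
Proof.
move=> [supp bnd uniq] ei' jlt; have lt := is_next_lt i'i.
have e0 k : i' < k -> e k = 0%N.
  move=> ik; apply/eqP; apply: contraTT ik => /supp /= ki'.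
  by rewrite -leNgt.
have e0' k m : is_next alpha (upto i) k m -> k < i' -> i' < m -> e k = 0%N.
  move=> km ki' i'm; have [k1 kk1 a1] := is_next_across km ki' i'm.
  by have := bnd _ _ ki' kk1; rewrite a1 ltnS leqn0 => /eqP.
split; last by rewrite fsfun_withE gt_eqF ?e0.
split=> [k|k m ki km|k m ink km k1 k2 k1m k2m].
- rewrite fsfun_withE /=; case: (eqVneq k i') => [-> _|_]; first exact: ltW.
  by move/supp => /= h; apply: le_trans h (ltW lt).
- rewrite fsfun_withE; case: (eqVneq k i') km => [->|ki'] km.
    by rewrite (is_next_inj km i'i).
  case: (ltgtP k i') ki' => // [ki' _|ki' _]; last by rewrite e0.
  case: (leP m i') => [mi'|i'm]; last by rewrite (e0' _ m).
  by apply: bnd ki' _; apply: is_next_restrict.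
have [mi|mi] := eqVneq m i.
  have eq k3 : is_next alpha (upto i) k3 m ->
      [fsfun e with i' |-> j] k3 != 0%N -> k3 = i'.
    rewrite fsfun_withE mi => k3i; case: (ltgtP k3 i') => // h.
      by rewrite (e0' _ i).
    by rewrite e0.
  by move=> /(eq _ k1m)-> /(eq _ k2m)->.
have mi' : m <= i'.
  rewrite leNgt; apply/negP => i'm.
  have mi2 : m < i by rewrite lt_neqAle mi (proj1 km : m <= i).
  have [_ [k' mk']] := is_next_between i'i i'm mi2.
  by case: km => _ [[_ /is_plus_omega_nosucc h]|[/(_ ink)]] //; exact: h mk'.
have ne k3 : is_next alpha (upto i) k3 m -> (k3 == i') = false.
  by move=> /is_next_lt h; rewrite lt_eqF // (lt_le_trans h).
rewrite !fsfun_withE !ne //.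
have om : is_plus_omega k m by case: km => _ [[]|[]].
apply: (uniq k m); try exact: is_next_restrict.
by case: ink => _ h; split=> //; exists m.
Qed.

(** The indices strictly between [i'] and [i] also have [i] as next index, so their exponents vanish
    by hypothesis and the support does not go beyond [i']. *)
Lemma standard_exponent_restrict e :
  standard_exponent alpha i e -> e i = 0%N ->
  (forall k, is_next alpha (upto i) k i -> k != i' -> e k = 0%N) ->
  standard_exponent alpha i' [fsfun e with i' |-> 0%N] /\ (e i' < alpha i)%N.
Proof.
move=> [supp bnd uniq] ei e0; have lt := is_next_lt i'i.
split; last exact: bnd lt i'i.
have ge0 k : i' < k -> e k = 0%N.
  move=> ik; apply/eqP; apply: contraTT ik => ek0; have /= := supp _ ek0.
  rewrite le_eqVlt => /predU1P[ki|ki]; first by rewrite ki ei eqxx in ek0.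
  rewrite -leNgt leNgt; apply/negP => i'k.
  have [ki' _] := is_next_between i'i i'k ki.
  by move: ek0; rewrite (e0 k ki') ?eqxx // gt_eqF.
split=> [k|k m ki km|k m ink km k1 k2 k1m k2m].
- rewrite fsfun_withE /=; case: (eqVneq k i') => [->|_] //.
  by apply: contraNT; rewrite -ltNge => /ge0->.
- rewrite fsfun_withE lt_eqF //.
  case: (is_next_extend km) => h; first by apply: bnd h; apply: lt_trans lt.
  by rewrite (e0 _ h) ?lt_eqF.
have om : is_plus_omega k m by case: km => _ [[]|[]].
have mi' : m <= i' := proj1 km.
have ext k3 : is_next alpha (upto i') k3 m -> is_next alpha (upto i) k3 m.
  move=> [_ [[h1 h2]|[_ /(is_plus_omega_nosucc om)//]]].
  split; first exact: le_trans mi' (ltW lt).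
  by left; split=> //; apply: inessential_upto h1; apply: ltW.
have ne k3 : is_next alpha (upto i') k3 m -> (k3 == i') = false.
  by move=> /is_next_lt h; rewrite lt_eqF // (lt_le_trans h).
rewrite !fsfun_withE !ne //.
apply: (uniq k m); try exact: ext.
exact: inessential_upto (ltW lt) ink.
Qed.

End Step.
End Next.

(** * Expansions *)

Lemma bigmin_seq_geP (d : Order.disp_t) (T : tOrderType d) (I : eqType) (r : seq I)
    (f : I -> T) (x : T) :
  reflect (forall i, i \in r -> (x <= f i)%O)
    (x <= \big[Order.min / \top%O]_(i <- r) f i)%O.
Proof.
elim: r => [|i r IH]; first by rewrite big_nil lex1; constructor.
rewrite big_cons le_min; apply: (iffP andP) => [[xi /IH h] j|h].
  by rewrite inE => /predU1P[->//|]; apply: h.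
by split; [apply: h; rewrite mem_head|apply/IH => j jr; apply: h; rewrite inE jr orbT].
Qed.

Lemma tofrac_sum (R : idomainType) I (r : seq I) (P : pred I) (f : I -> R) :
  tofrac (\sum_(i <- r | P i) f i) = \sum_(i <- r | P i) tofrac (f i).
Proof. exact: raddf_sum. Qed.

Lemma digit_sum (K : fieldType) (q : {poly K}) (c : nat -> {poly K}) n j :
  q \is monic -> (forall k, (k <= n)%N -> (size (c k) < size q)%N) ->
  digit q (\sum_(k < n.+1) c k * q ^+ k) j = if (j <= n)%N then c j else 0.
Proof.
move=> qm; have q0 := monic_neq0 qm.
elim: n c j => [|n IH] c j cs.
  rewrite big_ord_recl big_ord0 addr0 expr0 mulr1 /digit.
  case: j => [|j]; first by rewrite expr0 divp1 modp_small ?cs.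
  rewrite divp_small ?mod0p //; apply: leq_trans (cs 0%N _) _ => //.
  by rewrite dvdp_leq ?expf_neq0 // exprS dvdp_mulr.
rewrite big_ord_recl expr0 mulr1.
have -> : \sum_(i < n.+1) c (bump 0 i) * q ^+ bump 0 i
    = (\sum_(i < n.+1) c i.+1 * q ^+ i) * q.
  by rewrite mulr_suml; apply: eq_bigr => i _; rewrite exprSr mulrA.
have IH' := IH (fun i => c i.+1).
set g := \sum_(i < n.+1) _ in IH' *.
have c0 : (size (c 0%N) < size q)%N by apply: cs.
rewrite /digit; case: j => [|j].
  by rewrite expr0 divp1 modpD modp_mull addr0 modp_small.
rewrite exprS -divp_divl divpD mulpK // [c 0%N %/ q]divp_small // add0r.
by rewrite -/(digit q g j) IH' // => k kn; apply: cs.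
Qed.

Section Expansions.
Context (K : fieldType) (G : oagroupType).
Context (nu : valuation {fraction {poly K}} G).
Context (disp : Order.disp_t) (L : bOrderType disp).
Context (alpha : L -> nat) (Q : L -> {poly K}).
Local Notation nuv f := (vext nu (tofrac f)).
Implicit Types (i l : L) (e : exponent L) (c : expansion K L) (g : {poly K})
  (x : withtop G).

Lemma monomial_wide e (S : {fset L}) : (finsupp e `<=` S)%fset ->
  monomial Q e = \prod_(i <- S) Q i ^+ e i.
Proof.
move=> eS; apply: big_fset_incl => // i _ /fsfun_dflt->.
by rewrite expr0.
Qed.

Lemma monomial_with e i (n : nat) : e i = 0%N ->
  monomial Q [fsfun e with i |-> n] = monomial Q e * Q i ^+ n.
Proof.
move=> ei; have ie : i \notin finsupp e by rewrite mem_finsupp ei.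
rewrite (@monomial_wide _ (i |` finsupp e)%fset); last first.
  apply/fsubsetP => k; rewrite mem_finsupp fsfun_withE !inE.
  by case: (eqVneq k i) => //= _; rewrite mem_finsupp.
rewrite big_fsetU1 //= fsfun_withE eqxx mulrC; congr (_ * _).
rewrite big_seq [RHS]big_seq; apply: eq_bigr => k ke.
by rewrite fsfun_withE; case: (eqVneq k i) ke ie => // -> ->.
Qed.

Lemma expansion_val_wide c (S : {fset exponent L}) : (finsupp c `<=` S)%fset ->
  expansion_val Q c = \sum_(e <- S) c e *: monomial Q e.
Proof.
move=> cS; apply: big_fset_incl => // e _ /fsfun_dflt->.
by rewrite scale0r.
Qed.

Definition free_exponent l e := standard_exponent alpha l e /\ e l = 0%N.

(* As the bound x need not be the value of g, this is stable under sums. *)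
Definition bounded_expansion l x g : Prop := exists c,
  [/\ forall e, c e != 0 -> free_exponent l e, g = expansion_val Q c &
      forall e, x <= nuv (c e *: monomial Q e)].

Lemma bounded_expansion0 l x : bounded_expansion l x 0.
Proof.
exists [fsfun]; split=> [e|| e]; rewrite ?fsfun0E ?eqxx //.
  by rewrite /expansion_val finsupp0 big_seq_fset0.
by rewrite scale0r tofrac0 vext0 lex1.
Qed.

Lemma bounded_expansionD l x g h : bounded_expansion l x g ->
  bounded_expansion l x h -> bounded_expansion l x (g + h).
Proof.
move=> [c [cl -> cx]] [d [dl -> dx]].
pose S := (finsupp c `|` finsupp d)%fset.
have sE e : ([fsfun e in S => c e + d e | 0] : expansion K L) e = c e + d e.
  rewrite fsfunE inE !mem_finsupp; case: eqVneq => //= ->.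
  by case: eqVneq => //= ->; rewrite addr0.
exists [fsfun e in S => c e + d e | 0]; split=> [e||e]; rewrite ?sE.
- have [->|/cl//] := eqVneq (c e) 0.
  by rewrite add0r; apply: dl.
- rewrite [RHS](@expansion_val_wide _ S); last first.
    by apply/fsubsetP => e; rewrite mem_finsupp fsfunE; case: ifP; rewrite ?eqxx.
  rewrite (expansion_val_wide (fsubsetUl _ (finsupp d))).
  rewrite (expansion_val_wide (fsubsetUr (finsupp c) _)).
  by rewrite -big_split /=; apply: eq_bigr => e _; rewrite sE scalerDl.
by rewrite scalerDl tofracD; apply: vext_geD'.
Qed.

Lemma bounded_expansion_sum l x I (r : seq I) (P : pred I) (f : I -> {poly K}) :
  (forall k : I, P k -> bounded_expansion l x (f k)) ->
  bounded_expansion l x (\sum_(k <- r | P k) f k).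
Proof.
move=> h; elim/big_ind: _ => //; first exact: bounded_expansion0.
exact: bounded_expansionD.
Qed.

Lemma bounded_expansion_monomial l x e (a : K) : free_exponent l e ->
  x <= nuv (a *: monomial Q e) -> bounded_expansion l x (a *: monomial Q e).
Proof.
move=> el ax; pose c : expansion K L := [fsfun [fsfun] with e |-> a].
have cE e' : c e' = if e' == e then a else 0.
  by rewrite fsfun_withE fsfun0E.
exists c; split=> [e'||e']; rewrite ?cE.
- by case: (eqVneq e' e) => [->|]; rewrite ?eqxx.
- rewrite (@expansion_val_wide _ [fset e]%fset) ?big_seq_fset1 ?cE ?eqxx //.
  by apply/fsubsetP => e'; rewrite mem_finsupp cE inE; case: (eqVneq e' e); rewrite ?eqxx.
by case: (eqVneq e' e) => [->//|_]; rewrite scale0r tofrac0 vext0 lex1.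
Qed.

(** The value of a sum is at least the least value of its monomials, so the lower bound nu g on the
    latter gives an equality. *)
Lemma bounded_expansion_free l g : bounded_expansion l (nuv g) g ->
  exists2 c, free_expansion nu alpha Q l c & g = expansion_val Q c.
Proof.
move=> [c [cl gE cx]]; exists c => //; split.
  by move=> e; rewrite mem_finsupp; apply: cl.
rewrite -gE; apply/le_anti/andP; split.
  by apply/bigmin_seq_geP.
rewrite gE /expansion_val tofrac_sum [X in _ <= vext _ X]big_seq.
apply: vext_ge_sum => e ec.
have /bigmin_seq_geP h := lexx (\big[Order.min / \top%O]_(e <- finsupp c)
  nuv (c e *: monomial Q e)).
exact: h ec.
Qed.

Lemma free_expansion_le l c e : free_expansion nu alpha Q l c ->
  nuv (expansion_val Q c) <= nuv (c e *: monomial Q e).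
Proof.
move=> [_ ->]; have [ec|/fsfun_dflt->] := boolP (e \in finsupp c).
  have /bigmin_seq_geP h := lexx (\big[Order.min / \top%O]_(e <- finsupp c)
    nuv (c e *: monomial Q e)).
  exact: h ec.
by rewrite scale0r tofrac0 vext0 lex1.
Qed.

End Expansions.

(** * Key polynomials *)

Section InitialForms.
Context (F : fieldType) (G : oagroupType) (v : valuation F G).
Implicit Types (x y : F) (a : G).

Lemma initial_formM x y : x != 0 -> y != 0 ->
  initial_form v (x * y) = initial_form v x * initial_form v y.
Proof.
move=> x0 y0; rewrite /initial_form valuationM // gr_classM //.
  by rewrite vext_neq0.
by rewrite vext_neq0.
Qed.

Lemma initial_form_neq0 x : x != 0 -> initial_form v x != 0.
Proof. by move=> x0; rewrite gr_class_eq0 vext_neq0 ?lexx // ltxx. Qed.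

Lemma initial_form1 : initial_form v 1 = 1.
Proof.
rewrite /initial_form Defs.val1 /gr_class.
rewrite (_ : insubd _ _ = 1); first exact: rmorph1.
by apply: val_inj; rewrite insubdK ?reesU ?vext1 ?lexx // rmorph1.
Qed.

Lemma initial_formX x n : x != 0 -> initial_form v (x ^+ n) = initial_form v x ^+ n.
Proof.
move=> x0; elim: n => [|n IH]; first by rewrite !expr0 initial_form1.
by rewrite !exprS initial_formM ?expf_neq0 // IH.
Qed.

Lemma gr_class_initial_form a x : vext v x = Fin a -> gr_class v a x = initial_form v x.
Proof. by move=> /vext_Fin[_ <-]. Qed.

Lemma gr_class_sum I (r : seq I) (P : pred I) (f : I -> F) a :
  (forall i, P i -> Fin a <= vext v (f i)) ->
  gr_class v a (\sum_(i <- r | P i) f i) = \sum_(i <- r | P i) gr_class v a (f i).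
Proof.
move=> h; have [] : Fin a <= vext v (\sum_(i <- r | P i) f i) /\
  gr_class v a (\sum_(i <- r | P i) f i) = \sum_(i <- r | P i) gr_class v a (f i);
  last by [].
elim/big_rec2: _ => [|i x y Pi [ge e]].
  by rewrite vext0 lex1; split=> //; apply/eqP; rewrite gr_class_eq0 vext0 ?lex1.
by rewrite gr_classD ?h // e; split=> //; apply: vext_geD'; rewrite ?h.
Qed.

End InitialForms.

Section KeyPolynomialTheory.
Context (K : fieldType) (G : oagroupType).
Context (nu : valuation {fraction {poly K}} G).
Context (disp : Order.disp_t) (L : bOrderType disp).
Context (alpha : L -> nat) (Q : L -> {poly K}).
Hypothesis wfL : well_founded (fun i j : L => (i < j)%O).
Hypothesis keyQ : key_polynomials nu alpha Q.
Implicit Types (i k : L) (e : exponent L) (f g : {poly K}).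
Local Notation nuv f := (vext nu (tofrac f)).
Local Notation upto l := [pred q : L | (q <= l)%O].
Local Notation init f := (initial_form nu (tofrac f)).

Let alpha_gt0 i : (0 < alpha i)%N. Proof. by case: keyQ => -[]. Qed.

Lemma key_monic i : Q i \is monic. Proof. by case: keyQ => -[]. Qed.

Lemma key_neq0 i : Q i != 0. Proof. exact/monic_neq0/key_monic. Qed.

Lemma lt_not_maximum i j : (i < j)%O -> ~ is_maximum i.
Proof. by move=> ij /(_ j); rewrite leNgt ij. Qed.

Lemma is_succ_next i i' : is_succ i' i -> is_next alpha (upto i) i' i.
Proof.
move=> i'i; split; rewrite /= ?lexx //; right; split=> // -[[j i'j /= ji] _].
have := proj2 i'i _ (is_plus_omega_lt i'j) => ij.
have ei : i = j by apply/le_anti; rewrite ji ij.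
by apply: (is_plus_omega_nosucc i'j (k := i')); rewrite -ei.
Qed.

Lemma succ_or_limit i : i != \bot%O ->
  (exists i', is_succ i' i) \/
  (forall i', ~ is_succ i' i) /\ key_limit nu alpha Q i.
Proof.
move=> i0; have [|ns] := pselect (exists i', is_succ i' i); first by left.
have {}ns i' : ~ is_succ i' i by move=> h; apply: ns; exists i'.
by right; split=> //; case: keyQ => _ _ _ h _; apply: h.
Qed.

Lemma is_next_ex i : i != \bot%O -> exists i', is_next alpha (upto i) i' i.
Proof.
case/succ_or_limit=> [[i' /is_succ_next h]|[ns [[i' /(is_next_limit ns) h] _ _ _ _]]];
  by exists i'.
Qed.

(** Several indices may have [i] as next index when [i] is a limit, but the condition on inessential
    indices allows a nonzero exponent at only one of them. That one is chosen, or any one if there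
    is none. *)
Lemma is_next_ex_exponent i e : i != \bot%O -> standard_exponent alpha i e ->
  exists2 i', is_next alpha (upto i) i' i &
    forall k, is_next alpha (upto i) k i -> k != i' -> e k = 0%N.
Proof.
move=> i0 [_ _ uniq].
have [[k [ki ek]]|h] := pselect (exists k, is_next alpha (upto i) k i /\ e k != 0%N);
    last first.
  have [i' i'i] := is_next_ex i0; exists i' => // k ki _.
  apply/eqP; apply: contrapT => ek.
  by apply: h; exists k; split=> //; apply/negP.
exists k => // k' k'i k'k; apply/eqP; apply: contraNT k'k => ek'; apply/eqP.
have [[_ [[ik ok]|[_ sk]]]] := (ki); first exact: (uniq k i).
have k'lek : (k' <= k)%O by apply: (is_succ_le sk); apply: is_next_lt k'i.
move: k'lek; rewrite le_eqVlt => /predU1P[//|k'k].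
case: k'i => _ [[_ /is_plus_omega_nosucc h]|[_ [_ h]]]; first by case: (h _ sk).
by have := h _ k'k; rewrite leNgt (proj1 sk).
Qed.

Lemma free_exponent0 i : free_exponent alpha i [fsfun].
Proof.
split; last by rewrite fsfun0E.
by split=> [k|k m _ _|k m _ _ k1 k2 _ _]; rewrite !fsfun0E.
Qed.

Lemma monomial0 : monomial Q [fsfun] = 1.
Proof. by rewrite /monomial finsupp0 big_seq_fset0. Qed.

Lemma monomial_neq0 e : monomial Q e != 0.
Proof.
apply: monic_neq0; apply: monic_prod => i _.
by rewrite monic_exp // key_monic.
Qed.

Definition small_monomials i := forall e, free_exponent alpha i e ->
  (size (monomial Q e) < size (Q i))%N.

Lemma small_monomials_size i : small_monomials i -> (1 < size (Q i))%N.
Proof. by move=> /(_ _ (free_exponent0 i)); rewrite monomial0 size_poly1. Qed.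

Lemma size_free_expansion i (c : expansion K L) : small_monomials i ->
  free_expansion nu alpha Q i c -> (size (expansion_val Q c) < size (Q i))%N.
Proof.
move=> small [free _]; rewrite /expansion_val big_seq.
elim/big_ind: _ => [|f g fs gs|e /free/small].
- by rewrite size_poly0 size_poly_gt0 key_neq0.
- by apply: leq_ltn_trans (size_polyD f g) _; rewrite gtn_max fs gs.
exact/leq_ltn_trans/size_scale_leq.
Qed.

(** The degree condition on pre-key polynomials uses the next index computed in the whole of [L],
    where [i'] may be inessential, with next index i' + omega. At a successor [i] the degree is
    therefore read off the expansion of [Q i], whose lower terms have smaller degree. *)
Lemma deg_key i i' : ~ is_maximum i -> is_next alpha (upto i) i' i ->
  small_monomials i' -> (size (Q i)).-1 = (alpha i * (size (Q i')).-1)%N.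
Proof.
move=> imax i'i small; have lt := is_next_lt i'i.
have i0 : i != \bot%O by rewrite gt_eqF // (le_lt_trans (le0x i')).
have [_ [[ii' oi]|[_ si]]] := i'i.
  case: keyQ => -[_ _ _ _ h] _ _ _ _; apply: h => //.
  by split=> //; left; split=> //; apply: inessential_sub ii'.
have [c [cfree -> _ _]] : key_successor nu alpha Q i' i.
  by case: keyQ => _ _ h _ _; apply: h.
set d := (size (Q i')).-1.
have sX n : size (Q i' ^+ n) = (n * d).+1.
  by rewrite -[LHS]prednK ?size_poly_gt0 ?expf_neq0 ?key_neq0 // size_exp mulnC.
rewrite size_polyDl sX //.
apply: leq_ltn_trans (size_sum _ _ _) _; rewrite ltnS; apply/bigmax_leqP => j _.
have := size_free_expansion small (cfree j (ltn_ord j)).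
rewrite -[size (Q i')]prednK ?size_poly_gt0 ?key_neq0 // ltnS -/d => h.
apply: leq_trans (size_polyMleq _ _) _; rewrite sX addnS /=.
apply: (@leq_trans (j.+1 * d)); first by rewrite mulSn leq_add2r.
by rewrite leq_mul2r ltn_ord orbT.
Qed.

(* A free standard exponent e for i is e' + n i', where i' + = i, e' is free
   standard for i' and n < alpha i. *)
Lemma small_monomialsP i : ~ is_maximum i -> small_monomials i.
Proof.
elim/(well_founded_ind wfL): i => i IH imax e [se ei].
have [i0|i0] := eqVneq i \bot%O.
  have -> : e = [fsfun].
    apply/fsfunP => k; rewrite fsfun0E; apply/eqP; apply: contraT => ek.
    case: se => /(_ k ek) /=; rewrite i0 lex0 => /eqP k0.
    by rewrite k0 -i0 ei eqxx in ek.
  case: keyQ => -[_ _ _ Q0 _] _ _ _ _.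
  by rewrite monomial0 size_poly1 i0 Q0 size_polyX.
have [i' i'i e0] := is_next_ex_exponent i0 se.
have lt := is_next_lt i'i; have small := IH _ lt (lt_not_maximum lt).
have [se' ei'] := standard_exponent_restrict alpha_gt0 i'i se ei e0.
set e' := [fsfun e with i' |-> 0%N] in se'.
have e'i' : e' i' = 0%N by rewrite fsfun_withE eqxx.
have -> : e = [fsfun e' with i' |-> e i'].
  by apply/fsfunP => k; rewrite !fsfun_withE; case: (eqVneq k i') => [->|].
rewrite monomial_with //; have := small e' (conj se' e'i').
have := deg_key imax i'i small; set d := (size (Q i')).-1 => di.
have sQ k : size (Q k) = (size (Q k)).-1.+1 by rewrite prednK ?size_poly_gt0 ?key_neq0.
rewrite (sQ i') (sQ i) di !ltnS -/d => h.
apply: leq_trans (size_polyMleq _ _) _.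
rewrite -[size (Q i' ^+ _)]prednK ?size_poly_gt0 ?expf_neq0 ?key_neq0 //.
rewrite addnS /= size_exp -/d mulnC.
apply: (@leq_trans ((e i').+1 * d)); first by rewrite mulSn leq_add2r.
by rewrite leq_mul2r ei' orbT.
Qed.

Lemma size_key i : ~ is_maximum i -> (1 < size (Q i))%N.
Proof. by move=> /small_monomialsP/small_monomials_size. Qed.

Lemma digit_large i i' f (j : nat) : ~ is_maximum i -> is_next alpha (upto i) i' i ->
  (size f < size (Q i))%N -> (alpha i <= j)%N -> digit (Q i') f j = 0.
Proof.
move=> imax i'i fi ij; have lt := is_next_lt i'i.
have di := deg_key imax i'i (small_monomialsP (lt_not_maximum lt)).
rewrite /digit divp_small ?mod0p //; apply: leq_trans fi _.
rewrite -[size (Q i)]prednK ?size_poly_gt0 ?key_neq0 // di.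
rewrite -[size (Q i' ^+ _)]prednK ?size_poly_gt0 ?expf_neq0 ?key_neq0 //.
rewrite ltnS size_exp mulnC.
by rewrite leq_mul2l ij orbT.
Qed.

(** Free expansions have degree less than that of [Q i], so the coefficients of a standard expansion
    are the digits. *)
Lemma expansion_min_trunc i n c g : ~ is_maximum i ->
  standard_expansion nu alpha Q i n c g -> expansion_min nu Q i n c = trunc nu Q i g.
Proof.
move=> imax [cfree gE]; have small := small_monomialsP imax.
have dE (j : nat) : digit (Q i) g j = if (j <= n)%N then c j else 0.
  rewrite gE digit_sum ?key_monic // => k kn.
  by have [a fa ->] := cfree k kn; apply: size_free_expansion.
apply/le_anti/andP; split.
  apply/(truncP nu (key_monic i) (size_key imax)) => j; rewrite dE.
  case: leqP => jn; last by rewrite mul0r tofrac0 vext0 lex1.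
  exact: (@bigmin_le_cond _ _ _ _ (Ordinal (jn : (j < n.+1)%N)) xpredT
    (fun j : 'I_n.+1 => nuv (c j * Q i ^+ j))).
apply/bigmin_geP; split=> [|[j jn] _]; first exact: lex1.
have /(truncP nu (key_monic i) (size_key imax))/(_ j) := lexx (trunc nu Q i g).
by rewrite dE -ltnS jn.
Qed.

Definition free_complete i := forall g, (size g < size (Q i))%N ->
  exists2 c, free_expansion nu alpha Q i c & g = expansion_val Q c.

Lemma standard_expansion_ex i g : ~ is_maximum i -> free_complete i ->
  exists n c, standard_expansion nu alpha Q i n c g.
Proof.
move=> imax free; exists (size g), (digit (Q i) g); split.
  by move=> j _; apply: free; rewrite size_digit // size_key.
exact: digitE (size_key imax) _ _ _.
Qed.

Lemma initial_subring0 i : initial_subring Q i (0 : graded_algebra nu).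
Proof. by rewrite -(subrr 1); apply: gen_sub; apply: gen_one. Qed.

Lemma initial_subring_sum i I (r : seq I) (P : pred I) (x : I -> graded_algebra nu) :
  (forall t, P t -> initial_subring Q i (x t)) ->
  initial_subring Q i (\sum_(t <- r | P t) x t).
Proof.
move=> h; elim/big_ind: _ => [|y z hy hz|//]; first exact: initial_subring0.
rewrite -[z]opprK -[- z]add0r; apply: gen_sub => //.
by apply: gen_sub => //; apply: initial_subring0.
Qed.

Lemma initial_subring_monomial i e : free_exponent alpha i e ->
  initial_subring Q i (init (monomial Q e)).
Proof.
move=> [[supp _ _] ei]; rewrite /monomial big_seq.
pose S f := f != 0 /\ initial_subring Q i (init f).
have mul f g : S f -> S g -> S (f * g).
  move=> [f0 fi] [g0 gi]; split; first exact: mulf_neq0.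
  have fF0 : tofrac f != 0 by rewrite tofrac_eq0.
  have gF0 : tofrac g != 0 by rewrite tofrac_eq0.
  by rewrite tofracM (initial_formM nu fF0 gF0); exact (gen_mul fi gi).
have one : S 1.
  split; first exact: oner_neq0.
  by rewrite tofrac1 initial_form1; exact: gen_one.
suff [] : S (\prod_(k <- finsupp e | k \in finsupp e) Q k ^+ e k) by [].
elim/big_ind: _; [exact: one|exact: mul|move=> k; rewrite mem_finsupp => ek].
have ki : (k < i)%O.
  rewrite lt_neqAle (supp _ ek : (k <= i)%O) andbT.
  by apply: contraNneq ek => ->; rewrite ei.
elim: (e k) => [|n IH]; first by rewrite expr0; exact: one.
rewrite exprS; apply: mul IH; split; first exact: key_neq0.
by apply: gen_mem; right; exists k.
Qed.

(** As no monomial has value less than nu f, the initial form of f is the sum of those of the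
    monomials of value nu f, the other monomials having class 0 in that degree. *)
Lemma initial_subring_expansion i (c : expansion K L) : expansion_val Q c != 0 ->
  free_expansion nu alpha Q i c -> initial_subring Q i (init (expansion_val Q c)).
Proof.
set f := expansion_val Q c => f0 cfree.
have vf := vext_tofrac nu f0.
have ge e : Fin (nu (tofrac f)) <= nuv (c e *: monomial Q e).
  by rewrite -vf; apply: free_expansion_le cfree.
have fE : tofrac f = \sum_(e <- finsupp c) tofrac (c e *: monomial Q e).
  exact: tofrac_sum.
have -> : init f =
    \sum_(e <- finsupp c) gr_class nu (nu (tofrac f)) (tofrac (c e *: monomial Q e)).
  apply: (etrans (congr1 (gr_class nu (nu (tofrac f))) fE)).
  by apply: gr_class_sum => e _; apply: ge.
rewrite big_seq.
apply: initial_subring_sum => e ec.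
have := ge e; rewrite le_eqVlt => /predU1P[/esym eq|lt]; last first.
  have /eqP-> : gr_class nu (nu (tofrac f)) (tofrac (c e *: monomial Q e)) == 0.
    by rewrite gr_class_eq0 // ltW.
  exact: initial_subring0.
rewrite (gr_class_initial_form eq) -mul_polyC tofracM.
have ce0 : (c e)%:P != 0 by rewrite polyC_eq0 -mem_finsupp.
rewrite initial_formM ?tofrac_eq0 ?monomial_neq0 //.
apply: gen_mul; first by apply: gen_mem; left; exists (c e).
by apply: initial_subring_monomial; case: cfree => /(_ e ec).
Qed.

Lemma graded_fractions_subring (B : graded_algebra nu -> Prop) z :
  B 1 -> B z -> graded_fractions B z.
Proof.
move=> B1 Bz; exists z, 1; split=> //; rewrite ?mul1r ?oner_neq0 //.
exists 0, 1; split; first by rewrite vext1.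
by rewrite -initial_form1 (gr_class_initial_form (vext1 nu)).
Qed.

Lemma initial_formX_key i n : init (Q i ^+ n) = init (Q i) ^+ n.
Proof. by rewrite rmorphXn initial_formX ?tofrac_eq0 ?key_neq0. Qed.

(** The algebraic relation says that the class of [Q i] vanishes in degree [b], the common value of
    the monomials, so that the value of [Q i] exceeds [b]. But [Q i' ^+ alpha i] is a term of the
    expansion, so the truncation is at most [b]. *)
Lemma trunc_succ_key_lt i i' : ~ is_maximum i -> is_succ i' i ->
  trunc nu Q i' (Q i) < nuv (Q i).
Proof.
move=> imax i'i; have lt := is_next_lt (is_succ_next i'i).
have max' := lt_not_maximum lt; have small := small_monomialsP max'.
have [c [cfree QE ceq [_ _ rt _]]] : key_successor nu alpha Q i' i.
  by case: keyQ => _ _ h _ _; apply: h.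
have X0 n : Q i' ^+ n != 0 by rewrite expf_neq0 ?key_neq0.
pose b := nu (tofrac (Q i' ^+ alpha i)).
have vb : nuv (Q i' ^+ alpha i) = Fin b by rewrite vext_tofrac.
have term_eq (j : nat) e : (j < alpha i)%N -> e \in finsupp (c j) ->
    gr_class nu b (tofrac (c j e *: monomial Q e * Q i' ^+ j))
    = init (c j e)%:P * init (monomial Q e) * init (Q i') ^+ j.
  move=> ji ec; have := ceq j e ji ec; rewrite vb => /gr_class_initial_form->.
  have ce0 : (c j e)%:P != 0 by rewrite polyC_eq0 -mem_finsupp.
  rewrite -mul_polyC !tofracM !initial_formM ?mulf_neq0 ?tofrac_eq0 ?monomial_neq0 //.
  by rewrite initial_formX_key.
have term_ge (j : nat) : (j < alpha i)%N ->
    Fin b <= nuv (expansion_val Q (c j) * Q i' ^+ j).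
  move=> ji; rewrite /expansion_val mulr_suml tofrac_sum big_seq.
  by apply: vext_ge_sum => e ec; rewrite (ceq j e ji ec) vb.
have sum_ge : Fin b <= nuv (\sum_(j < alpha i) expansion_val Q (c j) * Q i' ^+ j).
  by rewrite tofrac_sum; apply: vext_ge_sum => -[j ji] _; apply: term_ge.
have Q_ge : Fin b <= nuv (Q i).
  by rewrite QE tofracD; apply: vext_geD'; rewrite ?vb.
have class0 : gr_class nu b (tofrac (Q i)) = 0.
  rewrite {1}QE tofracD gr_classD ?vb // (gr_class_initial_form vb) initial_formX_key.
  move/rootP: rt; rewrite hornerD hornerXn horner_sum => rt; rewrite -[RHS]rt {rt}.
  congr (_ + _); rewrite tofrac_sum gr_class_sum; last first.
    by move=> [j ji] _; apply: term_ge.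
  apply: eq_bigr => -[j ji] _ /=; rewrite hornerZ hornerXn.
  rewrite /expansion_val mulr_suml tofrac_sum big_seq gr_class_sum; last first.
    by move=> e ec; rewrite (ceq j e ji ec) vb.
  by rewrite [in RHS]big_seq mulr_suml; apply: eq_bigr => e ec; apply: term_eq.
have : Fin b < nuv (Q i) by rewrite -(gr_class_eq0 Q_ge); apply/eqP.
apply: le_lt_trans; rewrite -vb.
have dE : digit (Q i') (Q i) (alpha i) = 1.
  pose c' j := if (j < alpha i)%N then expansion_val Q (c j) else 1.
  have -> : Q i = \sum_(j < (alpha i).+1) c' j * Q i' ^+ j.
    rewrite big_ord_recr /= /c' ltnn mul1r addrC {1}QE; congr (_ + _).
    by apply: eq_bigr => -[j ji] _; rewrite /= ji.
  rewrite digit_sum ?key_monic ?leqnn /c' ?ltnn // => j _; case: ifP => ji.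
    by apply: size_free_expansion small _; apply: cfree.
  by rewrite size_poly1 size_key.
have /(truncP nu (key_monic i') (size_key max'))/(_ (alpha i)) :=
  lexx (trunc nu Q i' (Q i)).
by rewrite dE mul1r.
Qed.

(* Were trunc i' f < nu f, the initial forms of the digits of f would give a
   relation for in Q_i' of degree less than alpha i. *)
Lemma trunc_succ_eq i i' f : ~ is_maximum i -> is_succ i' i -> free_complete i' ->
  (size f < size (Q i))%N -> trunc nu Q i' f = nuv f.
Proof.
move=> imax i'i free fi; have i'i' := is_succ_next i'i; have lt := is_next_lt i'i'.
have max' := lt_not_maximum lt; have mi := key_monic i'; have si := size_key max'.
apply/eqP; rewrite eq_le trunc_le //= leNgt; apply/negP => flt.
have [c [_ _ _ [_ _ _ rel]]] : key_successor nu alpha Q i' i.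
  by case: keyQ => _ _ h _ _; apply: h.
set P := ('X^_ + _) in rel.
have [b eb] : exists b, trunc nu Q i' f = Fin b.
  by move: flt; case: (trunc _ _ _ _) => [b|]; [exists b|case: (nuv f)].
pose T j := digit (Q i') f j * Q i' ^+ j.
have T_ge j : Fin b <= nuv (T j).
  by move: j; apply/(truncP nu mi si); rewrite eb.
(* Only the classes in degree [b] enter the relation: terms of larger value contribute the
   coefficient 0. *)
pose D j := if nuv (T j) == Fin b then init (digit (Q i') f j) else 0.
have TD j : gr_class nu b (tofrac (T j)) = D j * init (Q i') ^+ j.
  have := T_ge j; rewrite /D le_eqVlt eq_sym; case: eqVneq => [e _|_ /= Tlt].
    have [T0 _] := vext_Fin e; rewrite tofrac_eq0 mulf_eq0 negb_or in T0.
    case/andP: T0 => d0 X0; rewrite (gr_class_initial_form e) /T tofracM.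
    by rewrite initial_formM ?tofrac_eq0 // initial_formX_key.
  by rewrite mul0r; apply/eqP; rewrite gr_class_eq0.
have D0 j : (alpha i <= j)%N -> D j = 0.
  move=> ij; rewrite /D /T (digit_large imax i'i' fi ij) mul0r tofrac0 vext0.
  by rewrite (_ : _ == _ = false).
have Pgt : (alpha i < size P)%N.
  rewrite ltnNge; apply/negP => /leq_sizeP/(_ _ (leqnn _)).
  rewrite /P coefD coefXn eqxx coef_sum big1 ?addr0; last first.
    by move=> [j ji] _; rewrite coefZ coefXn gtn_eqF ?mulr0.
  by move/eqP; rewrite oner_eq0.
pose P' := \poly_(j < size f) D j.
(* As nu f exceeds [b], the class of [f] in degree [b] is 0. *)
have P'root : root P' (init (Q i')).
  apply/rootP; rewrite horner_poly.
  rewrite (eq_bigr (fun j : 'I_(size f) => gr_class nu b (tofrac (T j)))); last first.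
    by move=> j _; rewrite TD.
  rewrite -gr_class_sum; last by move=> j _; apply: T_ge.
  rewrite -tofrac_sum -(digitE si (leqnn _)).
  by apply/eqP; rewrite gr_class_eq0 -?eb // ltW.
have P'0 : P' != 0.
  apply/eqP => P'0; move: flt; rewrite ltNge eb => /negP; apply.
  rewrite leNgt; apply/negP => flt.
  have Dj0 j : D j = 0.
    case: (ltnP j (size f)) => jf; last first.
      by rewrite /D /T (digit_ge_size si jf) mul0r tofrac0 vext0 (_ : _ == _ = false).
    by move/polyP: P'0 => /(_ j); rewrite coef_poly jf coef0.
  (* The truncation of 0 is an empty minimum, that is, top. *)
  have f0 : f != 0.
    by apply: contra_eq_neq eb => ->; rewrite /trunc size_poly0 big_ord0.
  have [j0] : exists j : nat, nuv (T j) = Fin b.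
    have i0 : 'I_(size f) by exists 0%N; rewrite size_poly_gt0.
    have [j1 _ ej1] := eq_bigmin (x := \top%O) i0 xpredT
      (fun j : 'I_(size f) => trunc_term nu Q i' f j) isT (fun j _ => lex1 _).
    by exists j1; rewrite /T -trunc_termE ?key_neq0 // -ej1 -eb.
  move=> e; have := Dj0 j0; rewrite /D e eqxx; have [T0 _] := vext_Fin e.
  rewrite tofrac_eq0 mulf_eq0 negb_or in T0; case/andP: T0 => d0 _.
  by move/eqP; apply/negP/initial_form_neq0; rewrite tofrac_eq0.
have := rel P' P'0 _ P'root; rewrite leqNgt => /(_ _)/negP; apply; last first.
  apply: leq_ltn_trans Pgt; apply/leq_sizeP => j ij.
  by rewrite coef_poly; case: ifP => // _; apply: D0.
move=> j; apply: graded_fractions_subring; first exact: gen_one.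
rewrite coef_poly; case: ifP => _; last exact: initial_subring0.
rewrite /D; case: eqP => [e|_]; last exact: initial_subring0.
have [T0 _] := vext_Fin e; rewrite tofrac_eq0 mulf_eq0 negb_or in T0.
case/andP: T0 => d0 _; have [a fa da] := free (digit (Q i') f j) (size_digit si _ _).
by rewrite da in d0 *; apply: initial_subring_expansion fa.
Qed.

End KeyPolynomialTheory.

(** * Slopes of key polynomials *)

Section KeySlopes.
Context (K : fieldType) (G : oagroupType).
Context (nu : valuation {fraction {poly K}} G).
Context (disp : Order.disp_t) (L : bOrderType disp).
Context (alpha : L -> nat) (Q : L -> {poly K}).
Hypothesis wfL : well_founded (fun i j : L => (i < j)%O).
Hypothesis keyQ : key_polynomials nu alpha Q.
Implicit Types (i k : L) (e : exponent L) (f g : {poly K}).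
Local Notation nuv f := (vext nu (tofrac f)).
Local Notation upto l := [pred q : L | (q <= l)%O].

Let alpha_gt0 i : (0 < alpha i)%N. Proof. by case: keyQ => -[]. Qed.

Lemma trunc_limit_key_lt i i' : key_limit nu alpha Q i -> is_next alpha predT i' i ->
  trunc nu Q i' (Q i) < nuv (Q i).
Proof.
move=> [_ std lt _ _] i'i; have [c hc] := std i' i'i.
have := lt i' c i'i hc; rewrite (expansion_min_trunc wfL keyQ _ hc) //.
exact/lt_not_maximum/is_next_lt/i'i.
Qed.

(** If all the truncations at indices i' with i'+ = i were less than nu f, then [f] would have the
    property for which [Q i] has the least degree. *)
Lemma trunc_limit_eq i f : key_limit nu alpha Q i ->
  (forall i', is_next alpha predT i' i -> free_complete nu alpha Q i') ->
  ((size f).-1 < (size (Q i)).-1)%N ->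
  exists2 i', is_next alpha predT i' i & trunc nu Q i' f = nuv f.
Proof.
move=> [_ _ _ minQ _] free fi; apply: contrapT => nh.
suff /minQ : limit_property nu alpha Q i f by rewrite leqNgt fi.
move=> i' i'i; have max' := lt_not_maximum (is_next_lt i'i).
split; first exact (standard_expansion_ex wfL keyQ f max' (free i' i'i)).
move=> n c hc; rewrite (expansion_min_trunc wfL keyQ max' hc) lt_neqAle.
rewrite trunc_le ?(key_monic keyQ) ?(size_key wfL keyQ max') // andbT.
by apply/eqP => e; apply: nh; exists i'.
Qed.

Lemma trunc_next_eq i f : ~ is_maximum i -> i != \bot%O ->
  (forall i', (i' < i)%O -> free_complete nu alpha Q i') ->
  (size f < size (Q i))%N ->
  exists i', [/\ is_next alpha (upto i) i' i, trunc nu Q i' f = nuv f &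
                 trunc nu Q i' (Q i) < nuv (Q i)].
Proof.
move=> imax i0 free fi; case: (succ_or_limit keyQ i0) => [[i' i'i]|[ns lim]].
  have i'n := is_succ_next alpha i'i.
  exists i'; split=> //; last exact (trunc_succ_key_lt wfL keyQ imax i'i).
  by apply: (trunc_succ_eq wfL keyQ imax i'i) => //; apply: free (is_next_lt i'n).
have [||i' i'i e] := @trunc_limit_eq i f lim.
- by move=> i' /is_next_lt; apply: free.
- move: fi (size_key wfL keyQ imax).
  by case: (size f) => [|m]; case: (size (Q i)) => [|[|n]].
by exists i'; split=> //; [apply: is_next_limit|apply: trunc_limit_key_lt].
Qed.

Lemma size_key_bot f : (size f < size (Q \bot%O))%N -> exists a, f = a%:P.
Proof.
have -> : Q \bot%O = 'X by case: keyQ => -[].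
by rewrite size_polyX ltnS => /size1_polyC->; exists f`_0.
Qed.

(** For a suitable i' with i'+ = i, the truncation of [g] at [i'] is nu g. Expanding the digits by
    induction and multiplying out gives monomials of value at least nu g, which are free i-standard
    because the exponents of [Q i'] are less than [alpha i]. *)
Lemma free_completeP i : ~ is_maximum i -> free_complete nu alpha Q i.
Proof.
elim/(well_founded_ind wfL): i => i IH imax g gi.
apply: bounded_expansion_free.
have [i0|i0] := eqVneq i \bot%O.
  rewrite i0 in gi *; have [a ->] := size_key_bot gi.
  rewrite -[a%:P]mulr1 mul_polyC -(monomial0 Q).
  by apply: bounded_expansion_monomial; first exact: free_exponent0 keyQ _.
have free i' : (i' < i)%O -> free_complete nu alpha Q i'.
  by move=> i'i; apply: IH => //; apply: lt_not_maximum i'i.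
have [i' [i'i tg _]] := trunc_next_eq imax i0 free gi.
have lt := is_next_lt i'i; have max' := lt_not_maximum lt.
have si := size_key wfL keyQ max'.
rewrite {2}(digitE si (leqnn (size g))).
apply: bounded_expansion_sum => -[j jg] _ /=.
case: (leqP (alpha i) j) => ij.
  rewrite (digit_large wfL keyQ imax i'i gi ij) mul0r.
  exact: bounded_expansion0.
have Tge : nuv g <= nuv (digit (Q i') g j * Q i' ^+ j).
  by move: {jg ij} j; apply/(truncP nu (key_monic keyQ i') si); rewrite tg.
have [c cfree dE] := free i' lt _ (size_digit si g j).
rewrite {}dE in Tge *; rewrite /expansion_val mulr_suml big_seq.
apply: bounded_expansion_sum => e ec.
have [se ei'] : free_exponent alpha i' e by case: cfree => /(_ e ec).
rewrite -scalerAl -monomial_with //.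
apply: bounded_expansion_monomial.
  exact: standard_exponent_extend.
apply: (le_trans Tge); rewrite monomial_with // scalerAl !tofracM.
apply: vext_leM2r; exact: free_expansion_le cfree.
Qed.

Lemma key_slope_ex i : ~ is_maximum i -> exists b a N, key_slope nu (Q i) b a N.
Proof.
elim/(well_founded_ind wfL): i => i IH imax.
have si := size_key wfL keyQ imax; have q0 := key_neq0 keyQ i.
have [i0|i0] := eqVneq i \bot%O; last first.
  apply: (@key_slope_step _ _ nu _ _ Q) => // g g0 gi.
  have [|i' [i'i tg tq]] := trunc_next_eq imax i0 _ gi.
    by move=> i' /lt_not_maximum; apply: free_completeP.
  have lt := is_next_lt i'i; have max' := lt_not_maximum lt.
  exists i'; split=> //; first exact (key_monic keyQ _).
    exact (size_key wfL keyQ max').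
  exact: IH.
have [b [a [N [b0 N0 s]]]] := max_slope nu si; exists b, a, N; split=> // g g0.
rewrite i0 => /size_key_bot[x gx].
(* The first key polynomial is ['X], so [g] is a constant and its Taylor expansion has no term of
   positive degree. *)
have D (k : nat) : (0 < k)%N -> g^`N(k) = 0 by rewrite gx nderivnC; case: k.
have e0 : vext (scaleval nu b) (tofrac g^`N(0)) = Fin (nu (tofrac g) *+ b - a *+ 0).
  by rewrite nderivn0 mulr0n subr0 vext_neq0 ?tofrac_eq0.
split=> [|[|k]|k k0]; rewrite coef_taylor ?e0 //.
  by rewrite D // rmorph0 vext0 lex1.
by rewrite D // rmorph0 vext0.
Qed.

Lemma key_slope_plus_lt i k (t : nat) b a N b' a' N' :
  ~ is_maximum k -> is_plus i t.+1 k ->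
  key_slope nu (Q i) b a N -> key_slope nu (Q k) b' a' N' -> a *+ b' < a' *+ b.
Proof.
elim: t k b' a' N' => [|t IH] k b' a' N' kmax ik si sk.
  have {}ik : is_succ i k by case: ik => i' /= ->.
  have max' := lt_not_maximum (proj1 ik).
  have [b'0 _ sk' _] := sk.
  apply: (key_slope_lt (key_monic keyQ i) (size_key wfL keyQ max') b'0
    (key_neq0 keyQ k) sk' si).
  exact (trunc_succ_key_lt wfL keyQ kmax ik).
have [k' ik' k'k] := ik; have max' := lt_not_maximum (proj1 k'k).
have [b1 [a1 [N1 s1]]] := key_slope_ex max'.
have lt1 := IH _ _ _ _ max' ik' si s1.
have [b'0 _ sk' _] := sk.
have lt2 : a1 *+ b' < a' *+ b1.
  apply: (key_slope_lt (key_monic keyQ k') (size_key wfL keyQ max') b'0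
    (key_neq0 keyQ k) sk' s1).
  exact (trunc_succ_key_lt wfL keyQ kmax k'k).
have [b10 _ _ _] := s1; have [b0 _ _ _] := si.
rewrite -(oag_ltMn _ _ b10) mulrnAC; apply: (@lt_trans _ _ (a1 *+ b *+ b')).
  by rewrite oag_ltMn.
by rewrite mulrnAC [X in _ < X]mulrnAC oag_ltMn.
Qed.

End KeySlopes.

(** * The stable value of delta *)

Theorem proposition8p6 (K : fieldType) (G : oagroupType)
    (nu : valuation {fraction {poly K}} G)
    (disp : Order.disp_t) (L : bOrderType disp)
    (alpha : L -> nat) (Q : L -> {poly K}) (l lw : L) (p delta : nat) :
  value_group nu = [set: G]%classic ->
  rank_one (value_group (restriction nu)) ->
  0 < nu (@tofrac {poly K} 'X) ->
  well_founded (fun i j : L => (i < j)%O) ->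
  countable [set: L]%classic ->
  key_polynomials nu alpha Q ->
  complete nu Q ->
  is_plus_omega l lw ->
  (forall t i, (0 < t)%N -> is_plus l t i -> alpha i = 1%N) ->
  stable_delta nu Q l (Q lw) delta ->
  char_exponent (residue_field nu) p ->
  exists e : nat, delta = (p ^ e)%N.
Proof.
move=> _ _ _ wfL _ keyQ _ omega_l alpha1 [N0 stable] char_p.
pose h := Q lw; have h0 : h != 0 := key_neq0 keyQ lw.
have lw0 : lw != \bot%O by rewrite gt_eqF // (le_lt_trans (le0x l)) // is_plus_omega_lt.
have ns k : ~ is_succ k lw := is_plus_omega_nosucc omega_l.
have lim : key_limit nu alpha Q lw by case: (succ_or_limit keyQ lw0) => [[k /ns]|[]].
have next_omega k : is_next alpha predT k lw -> is_plus_omega k lw.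
  by move=> [_ [[]|[_ /ns]]].
(* For t > 0 the index l + t is inessential, whereas [alpha l] itself may exceed 1; from [N0] on,
   delta is stable. *)
pose good k := exists t, [/\ (0 < t)%N, (N0 <= t)%N & is_plus l t k].
have good_next k : good k -> is_next alpha predT k lw.
  move=> [t [t0 _ lk]]; split=> //; left.
  have klw := is_plus_omega_shift omega_l lk; split=> //; split; first by exists lw.
  move=> s k' /(is_plusD lk); apply: alpha1.
  by rewrite addn_gt0 t0.
have good_delta k : good k -> trunc_delta nu Q k h = delta.
  by move=> [t [_ Nt lk]]; apply: stable Nt lk.
have next_slope k : is_next alpha predT k lw -> exists b a N, key_slope nu (Q k) b a N.
  by move=> /is_next_lt/lt_not_maximum kmax; exact (key_slope_ex wfL keyQ kmax).
have good_above i : (i < lw)%O -> exists2 k, good k & (i < k)%O.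
  move=> /(is_plus_omega_cofinal omega_l)[t [m [lm im]]].
  have [k lk _] := proj1 omega_l (maxn t N0).+1.
  exists k; first by exists (maxn t N0).+1; split=> //; rewrite leqW ?leq_maxr.
  have [k' lk' k'k] := lk; apply: (le_lt_trans im); apply: le_lt_trans (proj1 k'k).
  exact: is_plus_mono (leq_maxl t N0) lm lk'.
have slope_lt i k b a N b' a' N' : is_next alpha predT i lw -> good k -> (i < k)%O ->
    key_slope nu (Q i) b a N -> key_slope nu (Q k) b' a' N' -> a *+ b' < a' *+ b.
  move=> inext gk ik; have klw := is_next_lt (good_next _ gk).
  have [[|t] ikt] := is_plus_omega_between (next_omega _ inext) (ltW ik) klw.
    by move: ik; rewrite ikt ltxx.
  exact: key_slope_plus_lt wfL keyQ _ _ _ _ _ _ _ _ _ (lt_not_maximum klw) ikt.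
have side k b a N : good k -> key_slope nu (Q k) b a N ->
    exists c, taylor_side nu b a h (delta * N) c.
  move=> gk s; have max' := lt_not_maximum (is_next_lt (good_next _ gk)).
  have [c _ hc] := taylor_side_trunc (key_monic keyQ k) (size_key wfL keyQ max') s h0.
  by exists (c *+ b); rewrite -(good_delta k gk).
pose P M := `[< exists k b a N,
  [/\ good k, key_slope nu (Q k) b a N & M = (delta * N)%N] >].
have exP : exists M, P M.
  have [k gk _] := good_above l (is_plus_omega_lt omega_l).
  have [b [a [N s]]] := next_slope k (good_next _ gk).
  by exists (delta * N)%N; apply/asboolP; exists k, b, a, N.
(* delta N is the number of roots t of h with nu (x - t) at least the slope of
   Q_k, hence does not increase with k. *)
case: (ex_minnP exP) => M /asboolP[k0 [b0 [a0 [n0 [g0 s0 M0]]]]] minM.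
have M_gt0 : (0 < M)%N.
  have nx := good_next _ g0; have max' := lt_not_maximum (is_next_lt nx).
  rewrite M0 -(good_delta k0 g0).
  apply: (key_slope_trunc_gt0 (key_monic keyQ k0) (size_key wfL keyQ max') s0 h0).
  exact (trunc_limit_key_lt wfL keyQ lim nx).
have [e Me] : exists e, M = (p ^ e)%N.
  apply: contrapT => np.
  have [c cM uC] : exists2 c, (0 < c < M)%N & vext nu 'C(M, c)%:R = Fin 0.
    by apply: unit_binomial char_p M_gt0 _ => e Me; apply: np; exists e.
  have c0 : (0 < c)%N by case/andP: cM.
  (* By minimality of M, the derivative f of h has slope at least that of Q_k
     for all large k; but f has degree less than h, which bounds its slopes. *)
  pose f := h^`N(c).
  have [v0 sd0] := side k0 b0 a0 n0 g0 s0; rewrite -M0 in sd0.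
  have [f0 _] : f != 0 /\ _ := nderivn_slope cM uC sd0.
  have [||i inext tf] := @trunc_limit_eq _ _ nu _ _ alpha Q wfL keyQ lw f lim.
  - by move=> i /is_next_lt/lt_not_maximum imax; exact (free_completeP wfL keyQ imax).
  - by rewrite -ltnS !prednK ?size_poly_gt0 // size_nderivn_lt.
  have ilw := is_next_lt inext; have imax := lt_not_maximum ilw.
  have [b' [a' [N' si]]] := next_slope i inext.
  (* Past [i], the slope of [Q k] exceeds all those of [f]. Past [k0], the last contact of its line
     with the polygon of [h] is at most [M], hence equal to [M] by minimality. *)
  have [k gk ltk] : exists2 k, good k & (Order.max i k0 < k)%O.
    by apply: good_above; rewrite gt_max ilw (is_next_lt (good_next _ g0)).
  move: ltk; rewrite gt_max => /andP[ik k0k].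
  have [b [a [N s]]] := next_slope k (good_next _ gk).
  have [v sd] := side k b a N gk s.
  have b_gt0 : (0 < b)%N by case: s.
  have MN : (delta * N)%N = M.
    apply/eqP; rewrite eqn_leq minM ?andbT; last by apply/asboolP; exists k, b, a, N.
    have lt0 := slope_lt _ _ _ _ _ _ _ _ (good_next _ g0) gk k0k s0 s.
    by apply: taylor_side_index_le lt0 sd0 sd => //; case: s0.
  rewrite MN in sd; have [_] := nderivn_slope cM uC sd; apply.
  have [v' ev' sf] :=
    taylor_side_trunc (key_monic keyQ i) (size_key wfL keyQ imax) si f0.
  have lti := slope_lt _ _ _ _ _ _ _ _ inext gk ik si s.
  apply: (taylor_side_gt b_gt0 _ f0 lti (M := trunc_delta nu Q i f * N')).
    by case: si.
  have ev : v' = nu (tofrac f) by move: ev'; rewrite tf (vext_tofrac nu f0) => -[].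
  by rewrite ev in sf; exact: sf.
(* [delta] divides [M], and the divisors of a power of a prime are powers of that prime. *)
have : (delta %| p ^ e)%N by rewrite -Me M0 dvdn_mulr.
case: char_p => [chp|[_ ->]].
  by move=> /(dvdn_pfactor _ _ (pcharf_prime chp))[m _ ->]; exists m.
by rewrite exp1n dvdn1 => /eqP->; exists 0%N.
Qed.
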